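(* Let $\widetilde{\mathcal{C}} \subset \mathbb{P}^{r+1}$ be the standard rational normal curve of degree $r+1$, let $p \in \mathbb{P}^{r+1}\setminus \widetilde{\mathcal{C}}^2$ be a point with $\mathrm{rank}_{\widetilde{\mathcal{C}}}(p) \geq 4$, and let $$\mathcal{C} = \pi_p(\widetilde{\mathcal{C}}) \subset \mathbb{P}^r$$ be the resulting smooth rational curve of degree $r+1$. Then: (1) $\mathrm{rank\text{-}index}(\mathcal{C}) \leq 4$. (2) If $p = p_c$ is the $c$-th coordinate point of $\mathbb{P}^{r+1}$ (and hence $3 \leq c \leq r-2$), then $\mathrm{rank\text{-}index}(\mathcal{C}) = 3$.
   Context: Work over an algebraically closed field $\mathbb{K}$ of characteristic $0$. The standard rational normal curve of degree $r+1$ is $\widetilde{\mathcal{C}} = \{[s^{r+1} : s^{r}t : \cdots : t^{r+1}] \mid [s:t]\in \mathbb{P}^1\} \subset \mathbb{P}^{r+1}$. For $k \ge 1$, $\widetilde{\mathcal{C}}^k$ denotes the $k$-th self-join of $\widetilde{\mathcal{C}}$, i.e. the closure of the set of points lying in $(k-1)$-dimensional linear subspaces spanned by general collections of $k$ points of $\widetilde{\mathcal{C}}$. For $p \in \mathbb{P}^{r+1}$ put $\mathrm{rank}_{\widetilde{\mathcal{C}}}(p) = \min\{k \mid p \in \widetilde{\mathcal{C}}^k\}$. $\pi_p : \mathbb{P}^{r+1} \dashrightarrow \mathbb{P}^r$ denotes the linear projection from $p$. The coordinate points of $\mathbb{P}^{r+1}$ are $p_0, \dots, p_{r+1}$, where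 $p_c$ has $c$-th homogeneous coordinate $1$ and all others $0$. A closed subscheme $X \subset \mathbb{P}^r$ satisfies property $\mathrm{QR}(k)$ if its (saturated) homogeneous ideal is generated by quadratic polynomials of rank at most $k$ (the rank of a quadratic form is the rank of its associated symmetric matrix). If the homogeneous ideal of $X$ is generated by quadrics, $\mathrm{rank\text{-}index}(X)$ is the least integer $k$ such that $X$ satisfies property $\mathrm{QR}(k)$. (When $\mathrm{rank}_{\widetilde{\mathcal{C}}}(p)\ge 4$ the homogeneous ideal of $\mathcal{C}$ is generated by quadrics.) *)

(* Defs.v *)
From mathcomp Require Import all_boot all_algebra.
From mathcomp Require Import mpoly.

Set Implicit Arguments.
Unset Strict Implicit.
Unset Printing Implicit Defensive.

Import GRing.Theory.
Local Open Scope ring_scope.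

(* A point of P^n is represented by a nonzero row vector of length n.+1, two
   vectors representing the same point when they span the same line, that is
   when (x == y)%MS.  A subset of P^n is a predicate on vectors, consisting of
   the nonzero vectors of the corresponding cone. *)

Section ProjectiveSets.
Variables (K : fieldType) (n : nat).
Implicit Types (X S : 'rV[K]_n -> Prop) (x : 'rV[K]_n) (f q : {mpoly K[n]}).

Definition eval_at f x : K := f.@[fun i => x 0 i].

Definition homogeneous f : Prop := exists d : nat, f \is d.-homog.

Definition vanishes_on X f : Prop := forall x, X x -> eval_at f x = 0.

Definition zariski_closure X x : Prop :=
  x != 0 /\ forall f, homogeneous f -> vanishes_on X f -> eval_at f x = 0.

Definition ideal_gen (G : {mpoly K[n]} -> Prop) f : Prop :=
  exists (m : nat) (a g : 'I_m -> {mpoly K[n]}),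
    (forall i, G (g i)) /\ f = \sum_(i < m) a i * g i.

(* The homogeneous ideal of X with its reduced structure; it is saturated. *)
Definition homog_ideal X : {mpoly K[n]} -> Prop :=
  ideal_gen (fun f => homogeneous f /\ vanishes_on X f).

(* The rows of P are representatives of k points of X; row_free P says that
   these points span a linear subspace of dimension exactly k - 1, which is
   how a general collection of k points is understood. *)
Definition in_spanned_subspace X (k : nat) x : Prop :=
  x != 0 /\
  exists P : 'M[K]_(k, n),
    [/\ forall i, X (row i P), row_free P & (x <= P)%MS].

Definition self_join X (k : nat) : 'rV[K]_n -> Prop :=
  zariski_closure (in_spanned_subspace X k).

(* The symmetric matrix M with q = \sum_(i, j) M i j *: ('X_i * 'X_j), for q
   homogeneous of degree 2. *)
Definition quadric_mx q : 'M[K]_n :=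
  \matrix_(i, j) (if i == j then q@_(U_(i) + U_(j))%MM
                  else q@_(U_(i) + U_(j))%MM / 2%:R).

Definition quadric_rank q : nat := \rank (quadric_mx q).

Definition property_QR X (k : nat) : Prop :=
  exists G : {mpoly K[n]} -> Prop,
    (forall q, G q -> q \is 2.-homog /\ (quadric_rank q <= k)%N) /\
    (forall f, homog_ideal X f <-> ideal_gen G f).

End ProjectiveSets.

Definition is_least (P : nat -> Prop) (k : nat) : Prop :=
  P k /\ forall j : nat, P j -> (k <= j)%N.

(* The minima defining rank and rank-index are taken over sets that might be
   empty for arbitrary X, so both are relations between X and a number. *)
Definition has_rank (K : fieldType) (n : nat) (X : 'rV[K]_n -> Prop)
    (x : 'rV[K]_n) : nat -> Prop :=
  is_least (fun k => (1 <= k)%N /\ self_join X k x).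

Definition has_rank_index (K : fieldType) (n : nat)
    (X : 'rV[K]_n -> Prop) : nat -> Prop :=
  is_least (property_QR X).

Definition veronese_point (K : fieldType) (n : nat) (s t : K) : 'rV[K]_n.+1 :=
  \row_(i < n.+1) (s ^+ (n - i) * t ^+ i).

Definition rational_normal_curve (K : fieldType) (n : nat)
    (x : 'rV[K]_n.+1) : Prop :=
  exists s t : K, (s, t) != (0, 0) /\
    (x == veronese_point n s t)%MS.

(* A linear projection P^n --> P^(n-1) from p, determined by p up to linear
   changes of coordinates of the target: the map x |-> x *m A, where A has
   (row) kernel the line spanned by p, hence has full rank n. *)
Definition is_projection_from (K : fieldType) (n : nat) (p : 'rV[K]_n.+1)
    (A : 'M[K]_(n.+1, n)) : Prop :=
  (kermx A == p)%MS.

Definition projection_image (K : fieldType) (m n : nat) (A : 'M[K]_(m, n))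
    (X : 'rV[K]_m -> Prop) (y : 'rV[K]_n) : Prop :=
  y != 0 /\ exists2 x, X x & y = x *m A.

Definition coordinate_point (K : fieldType) (n : nat) (c : 'I_n) : 'rV[K]_n :=
  delta_mx 0 c.

(* Main.v *)
(* Let N = r + 1 and let W be the hyperplane of binary forms of degree N killed
   by the functional a defined by p; forms are dehomogenized throughout.  The
   linear forms on P^r are the elements of W, and the ideal of the curve is the
   kernel of the evaluation Sym W -> K[x].

   (1) As p has rank at least 4, the forms apolar to a are generated by coprime
   forms g0, g1 of degrees B + 2 and A + 2 with A, B >= 2 and A + B = N - 2, so
   that W = g0 S_A + g1 S_B and the curve lies on the scroll S(A, B).  Every
   polynomial is reduced modulo the minors of the scroll to a bigraded normal
   form, and dividing successively by g0 shows that the remaining generators are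
   the multiples of g1 (g0 h) - g0 (g1 h) of degree 2.  All these are relations
   u1 u2 = u3 u4 in W, since binary forms factor into linear ones; hence quadrics
   of rank at most 4.

   (2) For a coordinate point W is spanned by the monomials x^i with i <> c.
   Polarized conics u1 u2 = u3^2 of monomials make (i, j) |-> x_i x_j affine
   along the progressions avoiding c on each antidiagonal i + j = m, hence
   constant, except when m is one of 2c - 3, 2c - 1, 2c + 1, 2c + 3, where conics
   with non-monomial entries are used.  Conversely a quadric of rank at most 2
   is a product of two linear forms, and cannot vanish on the curve. *)

From HB Require Import structures.
Require Import Defs.
From mathcomp Require Import all_boot all_algebra.
From mathcomp Require Import mpoly.
From mathcomp Require Import ring zify.
From Stdlib Require Import Classical.

Set Implicit Arguments.
Unset Strict Implicit.
Unset Printing Implicit Defensive.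

Import GRing.Theory.
Local Open Scope ring_scope.

(** * Ideals, linear forms and ranks of quadrics *)

Section Ideals.

Context {K : fieldType} {n : nat}.
Implicit Types (G : {mpoly K[n]} -> Prop) (f g : {mpoly K[n]}).

(** Rank counts independent points of the curve, whereas an apolar form can have repeated roots and
    roots at infinity. A reparametrization [y = c + 1 / x] first moves all roots to the affine line;
    repeated roots are then pulled apart in a one-parameter family whose general member is spanned
    by [e] distinct points, and the Zariski closure contains the limit. So an apolar form of degree
    [e] places the point in the [e]-th join, and rank at least 4 forces the least such degree [e] to
    be at least 4. This is what keeps the generators quadratic. The relation between [g1 (g0 h)] and
    [g0 (g1 h)] lives in degree 2 only if [g0 h] fits into a bidegree (0, 2) or (1, 1), that is, if
    [h] has degree at most [B - 2] or [A - 2]; both ranges have to be nonempty. Characteristic 0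
    gives distinct slopes [i] for the moving roots, and the divisions by 2, 3 and 96 in the study of
    rank 3. *)

Definition ideal_pred (J : {mpoly K[n]} -> Prop) : Prop :=
  [/\ J 0, (forall f g, J f -> J g -> J (f + g))
    & (forall a f, J f -> J (a * f))].

Lemma ideal_gen_ideal G : ideal_pred (ideal_gen G).
Proof.
split.
- exists 0%N, (fun _ => 0), (fun _ => 0); split; first by case.
  by rewrite big_ord0.
- move=> f g [m1 [a1 [g1 [Gg1 ->]]]] [m2 [a2 [g2 [Gg2 ->]]]].
  exists (m1 + m2)%N.
  exists (fun i => match split i with inl j => a1 j | inr j => a2 j end).
  exists (fun i => match split i with inl j => g1 j | inr j => g2 j end).
  split; first by move=> i; case: (split i).
  rewrite big_split_ord; congr (_ + _); apply: eq_bigr => i _.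
    by rewrite (unsplitK (inl i)).
  by rewrite (unsplitK (inr i)).
- move=> a f [m [b [g [Gg ->]]]]; exists m, (fun i => a * b i), g; split=> //.
  by rewrite mulr_sumr; apply: eq_bigr => i _; rewrite mulrA.
Qed.

Lemma ideal_gen_incl G f : G f -> ideal_gen G f.
Proof.
move=> Gf; exists 1%N, (fun _ => 1), (fun _ => f); split=> //.
by rewrite big_ord1 mul1r.
Qed.

Lemma ideal_gen_least G J f :
  ideal_pred J -> (forall g, G g -> J g) -> ideal_gen G f -> J f.
Proof.
move=> [J0 JD JM] GJ [m [a [g [Gg ->]]]].
by elim/big_ind: _ => // i _; apply/JM/GJ.
Qed.

Section IdealTheory.
Variables (J : {mpoly K[n]} -> Prop) (idJ : ideal_pred J).

Lemma ideal0 : J 0. Proof. by case: idJ. Qed.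

Lemma idealD f g : J f -> J g -> J (f + g).
Proof. by case: idJ => _ + _; apply. Qed.

Lemma idealMl a f : J f -> J (a * f).
Proof. by case: idJ => _ _; apply. Qed.

Lemma idealMr a f : J f -> J (f * a).
Proof. by rewrite mulrC; apply: idealMl. Qed.

Lemma idealN f : J f -> J (- f).
Proof. by rewrite -mulN1r; apply: idealMl. Qed.

Lemma idealB f g : J f -> J g -> J (f - g).
Proof. by move=> Jf Jg; apply/idealD/idealN. Qed.

Lemma idealZ c f : J f -> J (c *: f).
Proof. by rewrite -mul_mpolyC; apply: idealMl. Qed.

Lemma ideal_sum I (s : seq I) (P : pred I) (F : I -> {mpoly K[n]}) :
  (forall i, P i -> J (F i)) -> J (\sum_(i <- s | P i) F i).
Proof.
by move=> JF; elim/big_ind: _ => //; [apply: ideal0 | apply: idealD].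
Qed.

Lemma ideal_cancel_scale c f : c != 0 -> J (c *: f) -> J f.
Proof. by move=> c0 /(idealZ c^-1); rewrite scalerA mulVf ?scale1r. Qed.

Lemma ideal_cong_trans f g h : J (f - g) -> J (g - h) -> J (f - h).
Proof. by move=> Jfg /(idealD Jfg); rewrite addrA subrK. Qed.

Lemma ideal_cong_sym f g : J (f - g) -> J (g - f).
Proof. by move/idealN; rewrite opprB. Qed.

End IdealTheory.

End Ideals.

Section LinearForms.

Context {K : fieldType} {n : nat}.
Implicit Types (a b : 'rV[K]_n).

Definition linform a : {mpoly K[n]} := \sum_(i < n) a 0 i *: 'X_i.

Lemma linformD a b : linform (a + b) = linform a + linform b.
Proof.
by rewrite -big_split; apply: eq_bigr => i _; rewrite mxE scalerDl.
Qed.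

Lemma linformZ k a : linform (k *: a) = k *: linform a.
Proof.
by rewrite scaler_sumr; apply: eq_bigr => i _; rewrite mxE scalerA.
Qed.

Lemma linform_delta i : linform (delta_mx 0 i) = 'X_i.
Proof.
rewrite /linform (bigD1 i) //= mxE !eqxx scale1r big1 ?addr0 // => j jNi.
by rewrite mxE eqxx (negPf jNi) scale0r.
Qed.

Lemma linform_homog a : linform a \is 1.-homog.
Proof.
by apply: rpred_sum => i _; apply: rpredZ; rewrite dhomogX; apply/eqP/mdeg1.
Qed.

Lemma linform_mul_homog a b : linform a * linform b \is 2.-homog.
Proof. exact: (dhomogM (linform_homog a) (linform_homog b)). Qed.

Lemma mnm1_pair_eq (i j k l : 'I_n) : (U_(i) + U_(j) == U_(k) + U_(l))%MM =
  ((i == k) && (j == l)) || ((i == l) && (j == k)).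
Proof.
apply/eqP/idP => [E|/orP[]/andP[/eqP-> /eqP->]//]; last by rewrite addmC.
have Ei := congr1 (fun m : 'X_{1..n} => m i) E.
have Ej := congr1 (fun m : 'X_{1..n} => m j) E.
have Ek := congr1 (fun m : 'X_{1..n} => m k) E.
have El := congr1 (fun m : 'X_{1..n} => m l) E.
move: Ei Ej Ek El; rewrite !mnmDE !mnm1E !eqxx.
rewrite (eq_sym j i) (eq_sym l k) (eq_sym k i) (eq_sym l i) (eq_sym k j) (eq_sym l j).
by do 6?case: eqP => //=; move=> *; subst.
Qed.

Lemma quadric_mxD (p q : {mpoly K[n]}) :
  quadric_mx (p + q) = quadric_mx p + quadric_mx q.
Proof.
apply/matrixP => i j; rewrite !mxE mcoeffD.
by case: ifP => // _; rewrite mulrDl.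
Qed.

Lemma quadric_mxZ c (p : {mpoly K[n]}) : quadric_mx (c *: p) = c *: quadric_mx p.
Proof.
apply/matrixP => i j; rewrite !mxE mcoeffZ.
by case: ifP => // _; rewrite mulrA.
Qed.

Lemma quadric_mx_sum I (s : seq I) (F : I -> {mpoly K[n]}) :
  quadric_mx (\sum_(i <- s) F i) = \sum_(i <- s) quadric_mx (F i).
Proof.
elim/big_rec2: _ => [|i ? ? _ <-]; last by rewrite quadric_mxD.
by apply/matrixP => i j; rewrite !mxE mcoeff0 mul0r if_same.
Qed.

Hypothesis two_neq0 : 2%:R != 0 :> K.

Lemma quadric_mx_X (i j : 'I_n) :
  quadric_mx ('X_i * 'X_j : {mpoly K[n]}) =
  2%:R^-1 *: (delta_mx i j + delta_mx j i).
Proof.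
apply/matrixP => k l; rewrite !mxE -mpolyXD mcoeffX mnm1_pair_eq.
rewrite (eq_sym i k) (eq_sym j l) (eq_sym i l) (eq_sym j k).
case: (eqVneq k l) => [->|kl].
  rewrite (andbC (l == j)) orbb.
  by case: andP => /= _; rewrite ?addr0 ?mulr0 // mulVf.
case: andP => [[/eqP? /eqP?]|]; subst => /=.
  by rewrite (negPf kl) /= addr0 mulrC.
by rewrite [(k == j) && _]andbC add0r mulrC.
Qed.

Lemma quadric_mx_mul a b :
  quadric_mx (linform a * linform b) = 2%:R^-1 *: (a^T *m b + b^T *m a).
Proof.
rewrite mulr_suml quadric_mx_sum.
transitivity (\sum_i \sum_j
  (a 0 i * b 0 j) *: (2%:R^-1 *: (delta_mx i j + delta_mx j i)) : 'M[K]_n).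
  apply: eq_bigr => i _; rewrite mulr_sumr quadric_mx_sum; apply: eq_bigr => j _.
  by rewrite -scalerAl -scalerAr scalerA quadric_mxZ quadric_mx_X.
apply/matrixP => k l; rewrite !mxE summxE !big_ord1 !mxE.
transitivity (2%:R^-1 * (\sum_i \sum_j a 0 i * b 0 j * ((k == i) && (l == j))%:R + \sum_i \sum_j a 0 i * b 0 j * ((k == j) && (l == i))%:R)).
  rewrite -big_split mulr_sumr /=; apply: eq_bigr => i _.
  rewrite summxE -big_split mulr_sumr /=; apply: eq_bigr => j _.
  by rewrite !mxE; ring.
congr (_ * (_ + _)).
  rewrite (bigD1 k) //= (bigD1 l) //= !eqxx mulr1 !big1 ?addr0 // => i.
    by move=> iNk; rewrite big1 // => j _; rewrite eq_sym (negPf iNk) mulr0.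
  by move=> iNk; rewrite andTb eq_sym (negPf iNk) mulr0.
rewrite (bigD1 l) //= (bigD1 k) //= !eqxx mulr1 !big1 ?addr0 1?mulrC // => i.
  by move=> iNk; rewrite big1 // => j _; rewrite (eq_sym l) (negPf iNk) andbF mulr0.
by move=> iNk; rewrite (eq_sym k) (negPf iNk) mulr0.
Qed.

Lemma rank_row_mul a b : (\rank (a^T *m b) <= 1)%N.
Proof. by apply: leq_trans (mxrankM_maxr _ _) (rank_leq_row _). Qed.

Lemma quadric_rankB (p q : {mpoly K[n]}) i j :
  (quadric_rank p <= i)%N -> (quadric_rank q <= j)%N ->
  (quadric_rank (p - q) <= i + j)%N.
Proof.
move=> rp rq; rewrite /quadric_rank quadric_mxD -scaleN1r quadric_mxZ.
apply: leq_trans (mxrank_add _ _) _; apply: leq_add => //.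
by rewrite mxrank_scale_nz ?oppr_eq0 ?oner_eq0.
Qed.

Lemma quadric_rank_mul a b : (quadric_rank (linform a * linform b) <= 2)%N.
Proof.
rewrite /quadric_rank quadric_mx_mul mxrank_scale_nz ?invr_eq0 //.
by apply: leq_trans (mxrank_add _ _) (@leq_add _ _ 1 1 _ _); apply: rank_row_mul.
Qed.

Lemma quadric_rank_sqr a : (quadric_rank (linform a * linform a) <= 1)%N.
Proof.
rewrite /quadric_rank quadric_mx_mul mxrank_scale_nz ?invr_eq0 //.
by rewrite -mulr2n -scaler_nat mxrank_scale_nz // rank_row_mul.
Qed.

Lemma mdeg2P (m : 'X_{1..n}) : mdeg m = 2%N -> exists i j, m = (U_(i) + U_(j))%MM.
Proof.
move=> dm.
have [i m_i] : exists i, (0 < m i)%N.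
  apply/existsP; apply: contraTT isT => /existsPn m0.
  by move: dm; rewrite mdegE big1 // => i _; move: (m0 i); case: (m i).
have ile : (U_(i) <= m)%MM.
  by apply/mnm_lepP => j; rewrite mnm1E; case: eqP => // <-.
have /eqP/mdeg1P[j /eqP mj] : mdeg (m - U_(i))%MM = 1%N.
  have := mdegD (m - U_(i))%MM U_(i); rewrite submK // dm mdeg1; lia.
by exists i, j; rewrite -mj addmC submK.
Qed.

Lemma quadric_mxP (q : {mpoly K[n]}) : q \is 2.-homog ->
  q = \sum_i \sum_j quadric_mx q i j *: ('X_i * 'X_j).
Proof.
move=> hq; apply/mpolyP => m.
have hs : \sum_i \sum_j quadric_mx q i j *: ('X_i * 'X_j) \is 2.-homog.
  do 2!apply: rpred_sum => ? _; apply: rpredZ.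
  by rewrite -mpolyXD dhomogX; apply/eqP; rewrite /= mdegD !mdeg1.
case: (eqVneq (mdeg m) 2%N) => [|m2]; last first.
  by rewrite (dhomog_nemf_coeff hq) // (dhomog_nemf_coeff hs).
move=> /mdeg2P[k [l ->]].
rewrite raddf_sum.
transitivity (\sum_i \sum_j quadric_mx q i j * (((i == k) && (j == l)) || ((i == l) && (j == k)))%:R).
  case: (eqVneq k l) => [->|kl].
    rewrite (bigD1 l) //= (bigD1 l) //= !eqxx !mxE eqxx mulr1 !big1 ?addr0 // => i il.
      by rewrite big1 // => j _; rewrite (negPf il) mulr0.
    by rewrite andTb orbb (negPf il) mulr0.
  rewrite (bigD1 k) //= (bigD1 l) //= [X in _ + X](bigD1 l) 1?eq_sym //=.
  rewrite [X in _ + (X + _)](bigD1 k) //= !eqxx orbT !mxE (negPf kl).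
  rewrite (eq_sym l) (negPf kl) !mulr1 addmC !big1 ?addr0.
  - by field.
  - move=> i /andP[il ik]; rewrite big1 // => j _.
    by rewrite (negPf il) (negPf ik) mulr0.
  - by move=> j jk; rewrite (negPf jk) /= mulr0.
  - by move=> j jk; rewrite (negPf jk) ?andbF /= mulr0.
apply: eq_bigr => i _; rewrite raddf_sum; apply: eq_bigr => j _.
by rewrite /= mcoeffZ -mpolyXD mcoeffX mnm1_pair_eq.
Qed.

End LinearForms.

(** * Curves on a rational normal scroll *)

Lemma poly_sum_bound (R : nzRingType) (h : {poly R}) N : (size h <= N)%N ->
  h = \sum_(k < N) h`_k *: 'X^k.
Proof.
move=> hN; rewrite -{1}[h]coefK poly_def.
rewrite (big_ord_widen_cond N (fun _ => true) (fun k => h`_k *: 'X^k)) // [RHS](bigID (fun k : 'I_N => (k < size h)%N)) /=.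
rewrite [X in _ = _ + X]big1 ?addr0 // => k.
by rewrite -leqNgt => /leq_sizeP/(_ k (leqnn k))->; rewrite scale0r.
Qed.

(** The roots are distributed between the two factors. This is how an algebraically closed field
    enters the bound 4: a form of bidegree of total degree 2 becomes one product of two linear forms
    instead of a sum of several. *)
Lemma poly_split (K : closedFieldType) (f : {poly K}) a b :
  (size f <= a + b + 1)%N ->
  exists p q : {poly K}, [/\ f = p * q, (size p <= a.+1)%N & (size q <= b.+1)%N].
Proof.
have [s ->] := closed_field_poly_normal f.
have [->|c0] := eqVneq (lead_coef f) 0.
  by exists 0, 0; rewrite scale0r mul0r size_poly0.
rewrite size_scale // size_prod_XsubC => szs.
exists (lead_coef f *: \prod_(z <- take a s) ('X - z%:P)).
exists (\prod_(z <- drop a s) ('X - z%:P)); split.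
- by rewrite -scalerAl -big_cat cat_take_drop.
- by rewrite size_scale // size_prod_XsubC size_take; case: ifP; lia.
- by rewrite size_prod_XsubC size_drop; lia.
Qed.

Section Scroll.

Variables (K : closedFieldType) (n : nat).
Variable J : {mpoly K[n]} -> Prop.
Hypothesis idJ : ideal_pred J.
Variables (w : 'I_n -> {poly K}) (L : {linear {poly K} -> {mpoly K[n]}}).
Variable W : {poly K} -> Prop.
Variables (A B : nat) (g0 g1 : {poly K}).

Let ev : {mpoly K[n]} -> {poly K} := mmap (@polyC K) w.
Let gen (b : bool) := if b then g0 else g1.
Let cap (b : bool) := if b then A else B.

Hypothesis A_ge2 : (2 <= A)%N.
Hypothesis B_ge2 : (2 <= B)%N.
Hypothesis size_g0 : size g0 = (B + 3)%N.
Hypothesis size_g1 : (size g1 <= A + 3)%N.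
Hypothesis coprime_g : coprimep g0 g1.
Hypothesis W_gen : forall b (p : {poly K}), (size p <= (cap b).+1)%N -> W (gen b * p).
Hypothesis ev_L : forall u, W u -> ev (L u) = u.
Hypothesis ev_J : forall f, J f -> ev f = 0.
Hypothesis J_quadric : forall u1 u2 u3 u4, W u1 -> W u2 -> W u3 -> W u4 ->
  u1 * u2 = u3 * u4 -> J (L u1 * L u2 - L u3 * L u4).
Hypothesis X_gen : forall k, exists p q : {poly K},
  [/\ (size p <= A.+1)%N, (size q <= B.+1)%N & 'X_k = L (g0 * p + g1 * q)].

(** * Normal forms modulo the minors of the scroll *)

Let v b k := L (gen b * 'X^k).

Let W_v b k : (k <= cap b)%N -> W (gen b * 'X^k).
Proof. by move=> kb; apply: W_gen; rewrite size_polyXn. Qed.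

Let v_move b b' k l k' l' : (k <= cap b)%N -> (l <= cap b')%N ->
  (k' <= cap b)%N -> (l' <= cap b')%N -> (k + l = k' + l')%N ->
  J (v b k * v b' l - v b k' * v b' l').
Proof.
move=> kb lb k'b l'b E; apply: J_quadric; try exact: W_v.
by rewrite mulrACA -exprD E exprD mulrACA.
Qed.

(** The normal form of a product of factors [v b k] with rulings [t] and total exponent [m]: the
    exponent is spent on the leftmost factors up to their capacity. An excess of [m] over [total t]
    is dropped, hence the bounds on [m] below. *)
Fixpoint greedy (t : seq bool) (m : nat) : {mpoly K[n]} :=
  if t is b :: t' then v b (minn (cap b) m) * greedy t' (m - minn (cap b) m)
  else 1.

Let total (t : seq bool) := sumn [seq cap b | b <- t].

(** A minor moves exponent between two factors, so exponent is drawn from the head of [greedy t m]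
    into the new factor. Either the head suffices to fill it, or the head is used up and the factors
    behind it have to contribute. *)
Lemma greedy_cons b t k m : (k <= cap b)%N -> (m <= total t)%N ->
  J (v b k * greedy t m - greedy (b :: t) (k + m)).
Proof.
elim: t b k m => [|b1 t IH] b k m kb /= mt.
  have -> : m = 0%N by move: mt; rewrite /total /=; lia.
  by rewrite addn0 (minn_idPr kb) subrr; apply: ideal0.
have {}mt : (m <= cap b1 + total t)%N by [].
set l := minn (cap b1) m; set k' := minn (cap b) (k + m).
have lb : (l <= cap b1)%N by rewrite geq_minl.
have lm : (l <= m)%N by rewrite geq_minr.
have k'b : (k' <= cap b)%N by rewrite geq_minl.
have k'm : (k' <= k + m)%N by rewrite geq_minr.
have kk' : (k <= k')%N by rewrite leq_min kb leq_addr.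
have mlt : (m - l <= total t)%N by rewrite /l; lia.
have [dl|ld] := leqP (k' - k) l.
  apply: (ideal_cong_trans idJ (g := v b k' * (v b1 (l - (k' - k)) * greedy t (m - l)))).
    rewrite !mulrA -mulrBl; apply: idealMr => //; apply: v_move => //; lia.
  rewrite -mulrBr; apply: idealMl => //.
  have := IH b1 (l - (k' - k))%N (m - l)%N _ mlt.
  have -> : (l - (k' - k) + (m - l) = k + m - k')%N by lia.
  by apply; lia.
(* As [k' - k] is at most [m], an insufficient head has [l < m] and is therefore full. It is emptied
   to [v b1 0], the rest is treated by induction, and [v b1 0] is reinserted behind the new factor
   by a second use of the induction. *)
have lE : l = cap b1 by move: ld; rewrite /l; lia.
have kl : (k + l <= cap b)%N by lia.
apply: (ideal_cong_trans idJ (g := v b1 0 * (v b (k + l) * greedy t (m - l)))).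
  rewrite !mulrA -mulrBl; apply: idealMr => //.
  by rewrite [v b1 0 * _]mulrC; apply: v_move; lia.
apply: (ideal_cong_trans idJ (g := v b1 0 * (v b k' * greedy t (k + m - k')))).
  rewrite -mulrBr; apply: idealMl => //.
  have := IH b (k + l)%N (m - l)%N kl mlt => /=.
  by have -> : (k + l + (m - l) = k + m)%N by lia.
rewrite mulrCA -mulrBr; apply: idealMl => //.
have := IH b1 0%N (k + m - k')%N (leq0n _).
by rewrite add0n; apply; rewrite /k'; lia.
Qed.

Let std i j := nseq i true ++ nseq j false.

Let total_std i j : total (std i j) = (i * A + j * B)%N.
Proof. by rewrite /total map_cat sumn_cat !map_nseq !sumn_nseq /= mulnC [(B * _)%N]mulnC. Qed.

(** [greedy_cons] adds a factor at the front, but a factor of the second ruling belongs behind the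
    sorted block of the first ruling; the block is taken off and put back factor by factor. *)
Lemma greedy_add_false i j k m : (k <= B)%N -> (m <= i * A + j * B)%N ->
  J (v false k * greedy (std i j) m - greedy (std i j.+1) (k + m)).
Proof.
elim: i m => [|i IH] m kB mle.
  by apply: (@greedy_cons false (std 0 j)); rewrite ?total_std.
 have mt : (m <= A + total (std i j))%N by rewrite total_std; lia.
rewrite [greedy (std i.+1 j) m]/=; set l := minn A m.
have lm : (m - l <= i * A + j * B)%N by rewrite /l; lia.
apply: (ideal_cong_trans idJ (g := v true l * greedy (std i j.+1) (k + (m - l)))).
  by rewrite mulrCA -mulrBr; apply: idealMl => //; apply: IH.
have := @greedy_cons true (std i j.+1) l (k + (m - l)) (geq_minl _ _).
rewrite total_std (_ : l + (k + (m - l)) = k + m)%N; last by rewrite /l; lia.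
by apply; lia.
Qed.

Lemma greedy_mul i j i' j' m m' :
  (m <= i * A + j * B)%N -> (m' <= i' * A + j' * B)%N ->
  J (greedy (std i j) m * greedy (std i' j') m'
     - greedy (std (i + i') (j + j')) (m + m')).
Proof.
move=> mle; elim: i' m' => [|i' IHi] m' m'le.
  elim: j' m' m'le => [|j' IHj] m' m'le.
    have -> : m' = 0%N by lia.
    by rewrite /= mulr1 !addn0 subrr; apply: ideal0.
  rewrite [greedy (std 0 _) m']/= -/(std 0 j'); set l := minn B m'.
  rewrite mulrCA addnS.
  apply: (ideal_cong_trans idJ (g := v false l * greedy (std (i + 0) (j + j')) (m + (m' - l)))).
    by rewrite -mulrBr; apply: idealMl => //; apply: IHj; rewrite /l; lia.
  have <- : (l + (m + (m' - l)) = m + m')%N by rewrite /l; lia.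
  by apply: greedy_add_false; rewrite /l; lia.
rewrite [greedy (std i'.+1 _) m']/= -/(std i' j'); set l := minn A m'.
rewrite mulrCA addnS.
apply: (ideal_cong_trans idJ (g := v true l * greedy (std (i + i') (j + j')) (m + (m' - l)))).
  by rewrite -mulrBr; apply: idealMl => //; apply: IHi; rewrite /l; lia.
have <- : (l + (m + (m' - l)) = m + m')%N by rewrite /l; lia.
by apply: (@greedy_cons true); rewrite ?total_std /l /=; lia.
Qed.

(* The class of [h], a form of degree [i A + j B], among the products of [i]
   linear forms of the first ruling and [j] of the second one. *)
Definition bracket i j (h : {poly K}) : {mpoly K[n]} :=
  \sum_(m < (i * A + j * B).+1) h`_m *: greedy (std i j) m.

Lemma bracketD i j h h' : bracket i j (h + h') = bracket i j h + bracket i j h'.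
Proof. by rewrite -big_split; apply: eq_bigr => m _; rewrite coefD scalerDl. Qed.

Lemma bracketZ i j c h : bracket i j (c *: h) = c *: bracket i j h.
Proof. by rewrite scaler_sumr; apply: eq_bigr => m _; rewrite coefZ scalerA. Qed.

Lemma bracket0 i j : bracket i j 0 = 0.
Proof. by rewrite -(scale0r 0) bracketZ scale0r. Qed.

Lemma bracket_sum i j I (s : seq I) (F : I -> {poly K}) :
  bracket i j (\sum_(k <- s) F k) = \sum_(k <- s) bracket i j (F k).
Proof. by elim/big_rec2: _ => [|k ? ? _ <-]; rewrite ?bracket0 ?bracketD. Qed.

Lemma bracketXn i j m : (m <= i * A + j * B)%N ->
  bracket i j 'X^m = greedy (std i j) m.
Proof.
rewrite -ltnS => mle; rewrite /bracket (bigD1 (Ordinal mle)) //=.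
rewrite coefXn eqxx scale1r big1 ?addr0 // => k; rewrite -val_eqE /= => kNm.
by rewrite coefXn (negPf kNm) scale0r.
Qed.

(** By bilinearity this is [greedy_mul] on monomials. From here on, computing modulo the minors
    amounts to multiplying polynomials and adding bidegrees. *)
Lemma bracket_mul i j i' j' (h h' : {poly K}) :
  (size h <= (i * A + j * B).+1)%N -> (size h' <= (i' * A + j' * B).+1)%N ->
  J (bracket i j h * bracket i' j' h' - bracket (i + i') (j + j') (h * h')).
Proof.
move=> sh sh'.
rewrite (poly_sum_bound sh) [in bracket (i + i') _ _]mulr_suml !bracket_sum mulr_suml -sumrB.
apply: ideal_sum => // k _.
rewrite (poly_sum_bound sh') [in bracket (i + i') _ _]mulr_sumr !bracket_sum mulr_sumr -sumrB.
apply: ideal_sum => // l _.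
rewrite -scalerAl -scalerAr -exprD !bracketZ -scalerAl -scalerAr -!scalerBr.
do 2!apply: idealZ => //.
by rewrite !bracketXn; [apply: greedy_mul|..]; have := ltn_ord k; have := ltn_ord l; lia.
Qed.

Lemma bracket10 (p : {poly K}) : (size p <= A.+1)%N -> bracket 1 0 p = L (g0 * p).
Proof.
move=> /poly_sum_bound ->; rewrite bracket_sum mulr_sumr linear_sum.
apply: eq_bigr => k _; rewrite bracketZ bracketXn; last by have := ltn_ord k; lia.
rewrite -scalerAr linearZ /= (_ : minn A k = k) ?mulr1 //.
by apply/minn_idPr; rewrite -ltnS.
Qed.

Lemma bracket01 (p : {poly K}) : (size p <= B.+1)%N -> bracket 0 1 p = L (g1 * p).
Proof.
move=> /poly_sum_bound ->; rewrite bracket_sum mulr_sumr linear_sum.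
apply: eq_bigr => k _; rewrite bracketZ bracketXn; last by have := ltn_ord k; lia.
rewrite -scalerAr linearZ /= (_ : minn B k = k) ?mulr1 //.
by apply/minn_idPr; rewrite -ltnS.
Qed.

(** * Relations between neighbouring bidegrees *)

Let W_g0 (p : {poly K}) : (size p <= A.+1)%N -> W (g0 * p).
Proof. exact: (W_gen (b := true)). Qed.

Let W_g1 (p : {poly K}) : (size p <= B.+1)%N -> W (g1 * p).
Proof. exact: (W_gen (b := false)). Qed.

(** Both brackets evaluate to [g0 * g1 ^+ 2 * h]. Splitting [g0 * h] and [g1 * h] into factors that
    each fit into one linear form turns the difference, modulo the minors, into a single relation
    [u1 u2 = u3 u4]. The bound on [h] is what [g0 * h] of degree at most [2 * B] allows. *)
Lemma bracket_quadric0 (h : {poly K}) : (size h <= B.-1)%N ->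
  J (bracket 0 2 (g0 * h) - bracket 1 1 (g1 * h)).
Proof.
move=> sh.
have [p [q [Epq sp sq]]] : exists p q, [/\ g0 * h = p * q, (size p <= B.+1)%N & (size q <= B.+1)%N].
  by apply: poly_split; apply: leq_trans (size_polyMleq _ _) _; rewrite size_g0; lia.
have [p' [q' [Epq' sp' sq']]] : exists p q, [/\ g1 * h = p * q, (size p <= A.+1)%N & (size q <= B.+1)%N].
  by apply: poly_split; apply: leq_trans (size_polyMleq _ _) _; lia.
have H1 := @bracket_mul 0 1 0 1 p q.
have H2 := @bracket_mul 1 0 0 1 p' q'.
rewrite -Epq in H1; rewrite -Epq' in H2.
apply: (ideal_cong_trans idJ (ideal_cong_sym idJ (H1 _ _))); try by lia.
apply: (ideal_cong_trans idJ _ (H2 _ _)); try by lia.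
rewrite !bracket01 // bracket10 //; apply: J_quadric; auto.
have -> : g1 * p * (g1 * q) = g1 * g1 * (p * q) by ring.
have -> : g0 * p' * (g1 * q') = g0 * g1 * (p' * q') by ring.
by rewrite -Epq -Epq'; ring.
Qed.

(** The companion relation, with common value [g0 ^+ 2 * g1 * h]; here [g0 * h] may have degree up
    to [A + B]. *)
Lemma bracket_quadric1 (h : {poly K}) : (size h <= A.-1)%N ->
  J (bracket 1 1 (g0 * h) - bracket 2 0 (g1 * h)).
Proof.
move=> sh.
have [p [q [Epq sp sq]]] : exists p q, [/\ g0 * h = p * q, (size p <= A.+1)%N & (size q <= B.+1)%N].
  by apply: poly_split; apply: leq_trans (size_polyMleq _ _) _; rewrite size_g0; lia.
have [p' [q' [Epq' sp' sq']]] : exists p q, [/\ g1 * h = p * q, (size p <= A.+1)%N & (size q <= A.+1)%N].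
  by apply: poly_split; apply: leq_trans (size_polyMleq _ _) _; lia.
have H1 := @bracket_mul 1 0 0 1 p q.
have H2 := @bracket_mul 1 0 1 0 p' q'.
rewrite -Epq in H1; rewrite -Epq' in H2.
apply: (ideal_cong_trans idJ (ideal_cong_sym idJ (H1 _ _))); try by lia.
apply: (ideal_cong_trans idJ _ (H2 _ _)); try by lia.
rewrite bracket01 // !bracket10 //; apply: J_quadric; auto.
have -> : g0 * p * (g1 * q) = g0 * g1 * (p * q) by ring.
have -> : g0 * p' * (g0 * q') = g0 * g0 * (p' * q') by ring.
by rewrite -Epq -Epq'; ring.
Qed.

Let size_g0_mul (H : {poly K}) : H != 0 -> size (g0 * H)%R = (B + 2 + size H)%N.
Proof.
have g0_neq0 : g0 != 0 by rewrite -size_poly_gt0 size_g0 addnS.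
by move=> H0; rewrite size_mul // size_g0 addn3 addSn addn2.
Qed.

(** Each monomial of [H] is split in two: one part, of degree at most [B - 2] or [A - 2], enters a
    quadratic relation, and the other fits into a bracket of the remaining bidegree. So these
    relations are multiples of quadrics in every degree. *)
Lemma bracket_shift i j (H : {poly K}) : (size (g0 * H)%R <= (i * A + j.+1 * B).+1)%N ->
  J (bracket i j.+1 (g0 * H) - bracket i.+1 j (g1 * H)).
Proof.
have [->|H0] := eqVneq H 0.
  by rewrite !mulr0 !bracket0 subrr => _; apply: ideal0.
rewrite size_g0_mul // => sH.
rewrite (poly_sum_bound (leqnn (size H))) !mulr_sumr !bracket_sum -sumrB.
apply: ideal_sum => // -[m mH] _ /=.
rewrite -!scalerAr !bracketZ -scalerBr; apply: idealZ => //.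
have sXn k (N : nat) : (k < N)%N -> (size ('X^k : {poly K}) <= N)%N.
  by rewrite size_polyXn.
have sg0X k : (size (g0 * 'X^k)%R <= B + 3 + k)%N.
  by apply: leq_trans (size_polyMleq _ _) _; rewrite size_polyXn size_g0; lia.
have sg1X k : (size (g1 * 'X^k)%R <= A + 3 + k)%N.
  by apply: leq_trans (size_polyMleq _ _) _; rewrite size_polyXn; lia.
case: j => [|j] in sH *; last first.
  pose m2 := minn m (B - 2); pose m1 := (m - m2)%N.
  have m1le : (m1 < (i * A + j * B).+1)%N. by move: sH; rewrite /m1 /m2 !mulSn; lia.
  have Em : 'X^m = 'X^m1 * 'X^m2 :> {poly K}.
    by rewrite -exprD /m1 /m2; congr (_ ^+ _); lia.
  rewrite Em !(mulrCA _ 'X^m1).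
  have H1 := @bracket_mul i j 0 2 'X^m1 (g0 * 'X^m2) (sXn _ _ m1le) (leq_trans (sg0X _) _).
  have H2 := @bracket_mul i j 1 1 'X^m1 (g1 * 'X^m2) (sXn _ _ m1le) (leq_trans (sg1X _) _).
  rewrite addn0 addn2 in H1; rewrite !addn1 in H2.
  apply: (ideal_cong_trans idJ (ideal_cong_sym idJ (H1 _))); first by rewrite /m2; lia.
  apply: (ideal_cong_trans idJ _ (H2 _)); last by rewrite /m2; lia.
  rewrite -mulrBr; apply: idealMl => //; apply: bracket_quadric0.
  by apply: sXn; rewrite /m2; lia.
(* In bidegree (0, 1) there is nothing to prove: a nonzero multiple of [g0] has degree above [B]. *)
case: i => [|i] in sH *; first by lia.
pose m2 := minn m (A - 2); pose m1 := (m - m2)%N.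
have m1le : (m1 < (i * A + 0 * B).+1)%N by rewrite /m1 /m2; lia.
have Em : 'X^m = 'X^m1 * 'X^m2 :> {poly K}.
  by rewrite -exprD /m1 /m2; congr (_ ^+ _); lia.
rewrite Em !(mulrCA _ 'X^m1).
have H1 := @bracket_mul i 0 1 1 'X^m1 (g0 * 'X^m2) (sXn _ _ m1le) (leq_trans (sg0X _) _).
have H2 := @bracket_mul i 0 2 0 'X^m1 (g1 * 'X^m2) (sXn _ _ m1le) (leq_trans (sg1X _) _).
rewrite addn1 in H1; rewrite addn2 in H2.
apply: (ideal_cong_trans idJ (ideal_cong_sym idJ (H1 _))); first by rewrite /m2; lia.
apply: (ideal_cong_trans idJ _ (H2 _)); last by rewrite /m2; lia.
rewrite -mulrBr; apply: idealMl => //; apply: bracket_quadric1.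
by apply: sXn; rewrite /m2; lia.
Qed.

Lemma ev_greedy t m : (m <= total t)%N ->
  ev (greedy t m) = \prod_(b <- t) gen b * 'X^m.
Proof.
elim: t m => [|b t IH] m mt /=.
  have -> : m = 0%N by move: mt; rewrite /total /=; lia.
  by rewrite big_nil mul1r expr0 /ev rmorph1.
have {}mt : (m <= cap b + total t)%N by [].
rewrite big_cons /ev rmorphM /= -/(ev _) -/(ev _) IH; last by lia.
rewrite ev_L; last by apply: W_v; rewrite geq_minl.
by rewrite mulrACA -exprD subnKC // geq_minr.
Qed.

Lemma ev_bracket i j (h : {poly K}) : (size h <= (i * A + j * B).+1)%N ->
  ev (bracket i j h) = g0 ^+ i * g1 ^+ j * h.
Proof.
move=> sh; rewrite {2}(poly_sum_bound sh) mulr_sumr /ev raddf_sum /=.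
apply: eq_bigr => m _; rewrite mmapZ -/(ev _) ev_greedy; last by rewrite total_std -ltnS.
rewrite mul_polyC -scalerAr; congr (_ *: (_ * _)).
by rewrite big_cat /= !big_nseq !iter_mulr_1.
Qed.

(** All terms after the first are divisible by [g0 ^+ i.+1], so coprimality gives [g0 %| H i];
    [bracket_shift] then carries the quotient into the term of index [i.+1], and the sum gets
    shorter. *)
Lemma brackets_vanish d (H : nat -> {poly K}) i : (i <= d)%N ->
  (forall k, (k <= d)%N -> (size (H k) <= (k * A + (d - k) * B).+1)%N) ->
  \sum_(i <= k < d.+1) g0 ^+ k * g1 ^+ (d - k) * H k = 0 ->
  J (\sum_(i <= k < d.+1) bracket k (d - k) (H k)).
Proof.
have g0_neq0 : g0 != 0 by rewrite -size_poly_gt0 size_g0; lia.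
move En : (d - i)%N => e; elim: e H i En => [|e IH] H i En id sH.
  have -> : i = d by lia.
  rewrite !big_nat1 subnn mulr1 => /eqP; rewrite mulf_eq0 expf_eq0 (negPf g0_neq0) andbF /=.
  by move/eqP->; rewrite bracket0; apply: ideal0.
have lid : (i < d)%N by lia.
rewrite big_ltn; last by lia.
rewrite big_nat_cond.
rewrite (eq_bigr (fun k => g0 ^+ i.+1 * (g0 ^+ (k - i.+1) * g1 ^+ (d - k) * H k))); last first.
  move=> k /andP[/andP[ik _] _]; rewrite !mulrA -exprD subnKC //.
rewrite -mulr_sumr; set S := (X in _ + _ * X) => E.
have dvd_H : g0 %| H i.
  rewrite -(@Gauss_dvdpr _ (H i) (g1 ^+ (d - i)) g0) ?coprimep_expr ?coprime_g //.
  apply/dvdpP; exists (- S); apply: (mulfI (expf_neq0 i g0_neq0)).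
  rewrite mulrA; move/eqP: E; rewrite addr_eq0 => /eqP->.
  by rewrite exprSr; ring.
have [H' EH'] : exists H', H i = g0 * H'.
  by case/dvdpP: dvd_H => H' ->; exists H'; rewrite mulrC.
pose H2 k := if k == i.+1 then H k + g1 * H' else H k.
have sg0H : (size (g0 * H')%R <= (i * A + (d - i) * B).+1)%N by rewrite -EH'; apply: sH.
have sg1H : (size (g1 * H')%R <= (i.+1 * A + (d - i.+1) * B).+1)%N.
  have [->|H'0] := eqVneq H' 0; first by rewrite mulr0 size_poly0.
  move: sg0H; rewrite size_g0_mul // => sH'.
  have dE : (d - i = (d - i.+1).+1)%N by lia.
  rewrite dE in sH'.
  by apply: leq_trans (size_polyMleq _ _) _; lia.
have sH2 k : (k <= d)%N -> (size (H2 k) <= (k * A + (d - k) * B).+1)%N.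
  move=> kd; rewrite /H2; case: eqP => [Ek|_]; last exact: sH.
  by apply: leq_trans (size_polyD _ _) _; rewrite geq_max sH // Ek.
have := IH H2 i.+1 _ lid sH2; rewrite big_ltn; last by lia.
have -> : \sum_(i.+2 <= k < d.+1) g0 ^+ k * g1 ^+ (d - k) * H2 k
   = \sum_(i.+2 <= k < d.+1) g0 ^+ k * g1 ^+ (d - k) * H k.
  by apply: eq_big_nat => k ik; rewrite /H2 ifF //; lia.
have E2 : g0 ^+ i.+1 * S = g0 ^+ i.+1 * g1 ^+ (d - i.+1) * H i.+1 +
   \sum_(i.+2 <= k < d.+1) g0 ^+ k * g1 ^+ (d - k) * H k.
  rewrite -big_ltn; last by lia.
  rewrite /S mulr_sumr [RHS]big_nat_cond; apply: eq_bigr => k /andP[/andP[ik _] _].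
  by rewrite !mulrA -exprD subnKC.
rewrite {1}/H2 eqxx.
have -> : g0 ^+ i.+1 * g1 ^+ (d - i.+1) * (H i.+1 + g1 * H')
   + \sum_(i.+2 <= k < d.+1) g0 ^+ k * g1 ^+ (d - k) * H k = 0.
  rewrite mulrDr addrAC -E2 -{}E addrC EH'.
  have -> : (d - i = (d - i.+1).+1)%N by lia.
  by rewrite !exprS; ring.
move=> /(_ _ erefl) JJ; have {}JJ := JJ ltac:(lia).
rewrite big_ltn; last by lia.
rewrite [X in J (_ + X)]big_ltn; last by lia.
rewrite big_ltn in JJ; last by lia.
rewrite /H2 eqxx bracketD in JJ.
have EE : \sum_(i.+2 <= k < d.+1) bracket k (d - k) (if k == i.+1 then H k + g1 * H' else H k)
   = \sum_(i.+2 <= k < d.+1) bracket k (d - k) (H k).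
  by apply: eq_big_nat => k ik; rewrite ifF //; lia.
rewrite EE in JJ.
have Ed : (d - i = (d - i.+1).+1)%N by lia.
have Jsh : J (bracket i (d - i) (g0 * H') - bracket i.+1 (d - i.+1) (g1 * H')).
  by rewrite {1}Ed; apply: bracket_shift; rewrite -Ed.
rewrite EH'.
rewrite (_ : _ + _ = (bracket i (d - i) (g0 * H') - bracket i.+1 (d - i.+1) (g1 * H')) +
 (bracket i.+1 (d - i.+1) (H i.+1) + bracket i.+1 (d - i.+1) (g1 * H') + \sum_(i.+2 <= k < d.+1) bracket k (d - k) (H k))).
  exact: idealD.
by ring.
Qed.

(** * Reduction of homogeneous polynomials to sums of brackets *)

Let represented d (F : {mpoly K[n]}) := exists H : nat -> {poly K},
  (forall k, (k <= d)%N -> (size (H k) <= (k * A + (d - k) * B).+1)%N) /\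
  J (F - \sum_(0 <= k < d.+1) bracket k (d - k) (H k)).

Let represented_lin d c F F' :
  represented d F -> represented d F' -> represented d (c *: F + F').
Proof.
move=> [H [sH JH]] [H' [sH' JH']]; exists (fun k => c *: H k + H' k); split.
  move=> k kd; apply: leq_trans (size_polyD _ _) _; rewrite geq_max sH' // andbT.
  by apply: leq_trans (size_scale_leq _ _) _; apply: sH.
under eq_bigr => k _ do rewrite bracketD bracketZ.
rewrite big_split -scaler_sumr /=.
rewrite (_ : _ - _ = c *: (F - \sum_(0 <= k < d.+1) bracket k (d - k) (H k)) +
  (F' - \sum_(0 <= k < d.+1) bracket k (d - k) (H' k))).
  by apply: idealD => //; apply: idealZ.
by rewrite scalerBr addrACA opprD.
Qed.

Let represented0 d : represented d 0.
Proof.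
exists (fun _ => 0); split; first by move=> k _; rewrite size_poly0.
by rewrite big1 ?subr0 => [|k _]; rewrite ?bracket0 //; apply: ideal0.
Qed.

Let represented_bracket d k (h : {poly K}) F : (k <= d)%N ->
  (size h <= (k * A + (d - k) * B).+1)%N -> J (F - bracket k (d - k) h) ->
  represented d F.
Proof.
move=> kd sh JF; exists (fun i => if i == k then h else 0); split.
  by move=> i _; case: eqP => [->|]; rewrite ?size_poly0.
have kin : k \in index_iota 0 d.+1 by rewrite mem_index_iota ltnS.
rewrite (bigD1_seq k kin (iota_uniq _ _)) /= eqxx big1 ?addr0 // => i.
by move/negPf->; rewrite bracket0.
Qed.

Let represented_cong d F F' : J (F - F') -> represented d F' -> represented d F.
Proof.
by move=> JF [H [sH JH]]; exists H; split=> //; apply: ideal_cong_trans JH.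
Qed.

Let represented_sum d I (s : seq I) (F : I -> {mpoly K[n]}) (P : pred I) :
  (forall i, P i -> represented d (F i)) -> represented d (\sum_(i <- s | P i) F i).
Proof.
move=> RF; elim/big_ind: _ => // x y rx ry.
by rewrite -[x]scale1r; apply: represented_lin.
Qed.

Let represented_mulX d k F : represented d F -> represented d.+1 ('X_k * F).
Proof.
move=> [H [sH JH]].
apply: (represented_cong (F' := 'X_k * \sum_(0 <= i < d.+1) bracket i (d - i) (H i))).
  by rewrite -mulrBr; apply: idealMl.
have [p [q [sp sq ->]]] := X_gen k.
rewrite linearD /= -bracket10 // -bracket01 // mulr_sumr big_nat.
apply: represented_sum => i; rewrite /= ltnS => id.
rewrite mulrDl -[X in X + _]scale1r; apply: represented_lin.
  apply: (@represented_bracket d.+1 i.+1 (p * H i)) => //.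
    by have := sH i id; have := size_polyMleq p (H i); rewrite subSS; lia.
  rewrite subSS; have := @bracket_mul 1 0 i (d - i) p (H i).
  by rewrite add1n add0n; apply; rewrite ?sH //; lia.
apply: (@represented_bracket d.+1 i (q * H i)); first by lia.
  by have := sH i id; have := size_polyMleq q (H i); rewrite subSn //; lia.
rewrite subSn //; have := @bracket_mul 0 1 i (d - i) q (H i).
by rewrite add1n add0n; apply; rewrite ?sH //; lia.
Qed.

Let represented_homog d F : F \is d.-homog -> represented d F.
Proof.
move=> hF; rewrite [F]mpolyE big_seq; apply: represented_sum => m mF.
have dm : mdeg m = d by apply: (dhomog_mf hF).
rewrite -[_ *: _]addr0; apply: represented_lin; last exact: represented0.
elim: d m dm {hF mF} => [|d IH] m dm.
  have -> : m = 0%MM by apply/eqP; rewrite -mdeg_eq0 dm.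
  apply: (@represented_bracket 0 0 1); rewrite ?size_poly1 //.
  by rewrite -(expr0 'X) bracketXn //= mpolyX0 subrr; apply: ideal0.
have [i m_i] : exists i, (0 < m i)%N.
  apply/existsP; apply: contraTT isT => /existsPn m0.
  by move: dm; rewrite mdegE big1 // => i _; move: (m0 i); case: (m i).
have ile : (U_(i) <= m)%MM.
  by apply/mnm_lepP => j; rewrite mnm1E; case: eqP => // <-.
rewrite -(submK ile) addmC mpolyXD; apply/represented_mulX/IH.
by have := mdegD (m - U_(i))%MM U_(i); rewrite submK // dm mdeg1; lia.
Qed.

Lemma scroll_ideal d F : F \is d.-homog -> ev F = 0 -> J F.
Proof.
move=> /represented_homog[H [sH JH]] evF.
rewrite -[F](subrK (\sum_(0 <= k < d.+1) bracket k (d - k) (H k))).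
apply: idealD => //; apply: brackets_vanish => //.
have := ev_J JH; rewrite /ev rmorphB /= -/(ev F) evF sub0r => /eqP.
rewrite oppr_eq0 raddf_sum /= => /eqP evB; rewrite -[RHS]evB.
rewrite !big_nat; apply: eq_bigr => k /andP[_ kd].
by rewrite -/(ev _) ev_bracket // sH.
Qed.

End Scroll.

(** * Generators of the apolar ideal of a binary form *)

Section ApolarGenerators.

Variables (K : fieldType) (N e : nat) (phi : {scalar {poly K}}) (g : {poly K}).
Hypothesis e_gt0 : (0 < e)%N.
Hypothesis e_le : (2 * e <= N + 2)%N.
Hypothesis g_monic : g \is monic.
Hypothesis size_g : size g = e.+1.
Hypothesis phi_g : forall p : {poly K}, (size p <= N.+1 - e)%N -> phi (g * p) = 0.
Hypothesis g_min : forall k : {poly K}, k \is monic -> (size k <= e)%N ->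
  exists p : {poly K}, (size p + size k <= N + 2)%N /\ phi (k * p) != 0.

Let g_neq0 : g != 0. Proof. exact: monic_neq0. Qed.

Let phi_poly (f h : {poly K}) m : (size h <= m)%N ->
  phi (f * h) = \sum_(i < m) h`_i * phi (f * 'X^i).
Proof.
move=> hm; rewrite {1}(poly_sum_bound hm) mulr_sumr linear_sum.
by apply: eq_bigr => i _; rewrite -scalerAr linearZ.
Qed.

Let size_divg (f : {poly K}) : size (f %/ g) = (size f - e)%N.
Proof. by rewrite size_divp // size_g. Qed.

Let phi_modp (f : {poly K}) : (size f <= N.+1)%N -> phi f = phi (f %% g).
Proof.
move=> sf; rewrite {1}(divp_eq f g) mulrC linearD /= phi_g ?add0r //.
by rewrite size_divg leq_sub2r.
Qed.

Let size_modg (f : {poly K}) : (size (f %% g)%R <= e)%N.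
Proof. by rewrite -ltnS -size_g ltn_modp. Qed.

Let size_mul_le (f h : {poly K}) :
  (size f <= e)%N -> (size h <= e)%N -> (size (f * h)%R <= N.+1)%N.
Proof. by move=> sf sh; have := size_polyMleq f h; lia. Qed.

Let size_mul_le_add (f h : {poly K}) :
  (size h + size f <= N + 2)%N -> (size (f * h)%R <= N.+1)%N.
Proof. by move=> s_fh; have := size_polyMleq f h; lia. Qed.

Let size_mulE (f h : {poly K}) : f != 0 -> h != 0 ->
  (size f + size h = size (f * h)%R + 1 /\ 0 < size h)%N.
Proof.
move=> f0 h0; rewrite size_mul // size_poly_gt0 h0 addn1 prednK //.
by rewrite addn_gt0 size_poly_gt0 f0.
Qed.

Let hankel : 'M[K]_e := \matrix_(i, j) phi ('X^(i + j)).

Let phi_rVpoly (v : 'rV[K]_e) (j : 'I_e) : phi (rVpoly v * 'X^j) = (v *m hankel) 0 j.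
Proof.
rewrite mulrC (phi_poly _ (size_poly _ _)) mxE; apply: eq_bigr => i _.
by rewrite coef_rVpoly_ord -exprD mxE addnC.
Qed.

(** A kernel vector is a polynomial [w] of degree below [e] such that [phi] kills [w * h] for all
    [h] of degree below [e]. Reduction modulo [g] extends this to the ideal of [w] and [g] in
    degrees up to [N], so their monic gcd would be apolar of degree below [e], against [g_min]. *)
Let hankel_unit : hankel \in unitmx.
Proof.
rewrite -row_free_unit -kermx_eq0; apply/eqP/row_matrixP => i0; rewrite row0.
set v := row i0 _.
have vH : v *m hankel = 0 by apply/sub_kermxP; apply: row_sub.
pose w := rVpoly v.
have phi_w (h : {poly K}) : (size h <= e)%N -> phi (w * h) = 0.
  move=> sh; rewrite (phi_poly _ sh) big1 // => j _.
  by rewrite phi_rVpoly vH mxE mulr0.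
have sw : (size w <= e)%N by apply: size_poly.
have phi_mod_w (h : {poly K}) : phi ((h * w) %% g) = 0.
  by rewrite mulrC -modp_mul -phi_modp ?size_mul_le ?phi_w ?size_modg.
apply: (can_inj (@rVpolyK _ e)); rewrite -/w linear0; apply/eqP/contraT => w0.
have k0 : gcdp w g != 0 by rewrite gcdp_eq0 negb_and w0.
pose c := (lead_coef (gcdp w g))^-1; pose k := c *: gcdp w g.
have c0 : c != 0 by rewrite invr_eq0 lead_coef_eq0.
have k_monic : k \is monic by rewrite monicE lead_coefZ mulVf ?lead_coef_eq0.
have sk : (size k <= e)%N.
  rewrite size_scale //; apply: leq_trans sw.
  by rewrite dvdp_leq // dvdp_gcdl.
have [p [sp /eqP[]]] := g_min k_monic sk.
have spk : (size (k * p)%R <= N.+1)%N by apply: size_mul_le_add.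
have [[al be] /= /eqpP[[c1 c2] /= /andP[c10 c20] E]] := Bezoutp w g.
rewrite phi_modp //.
have -> : k * p = (c * c2^-1 * c1) *: (al * p * w) + (c * c2^-1 * c1) *: (be * p * g).
  have -> : k = (c * c2^-1 * c1) *: (al * w + be * g).
    by rewrite -scalerA E scalerA mulfVK.
  by rewrite -!mul_polyC; ring.
rewrite modpD !modpZl modp_mull scaler0 addr0 linearZ /= phi_mod_w mulr0 //.
Qed.

(** [u] is dual to the last monomial for the Hankel form: [phi (u * q)] is the coefficient of
    ['X^(e.-1)] in [q] for [q] of degree below [e]. It dehomogenizes the second generator, of degree
    [N + 2 - e]. *)
Lemma apolar_second_generator : exists u : {poly K},
  [/\ (size u <= e)%N, coprimep g u,
      forall q : {poly K}, (size q <= e.-1)%N -> phi (u * q) = 0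
    & forall w : {poly K}, (size w <= N.+1)%N -> phi w = 0 ->
        exists p q : {poly K}, [/\ (size p <= N.+1 - e)%N, (size q <= e.-1)%N
                      & w = g * p + u * q]].
Proof.
have lt_e : (e.-1 < e)%N by rewrite prednK.
pose v : 'rV[K]_e := delta_mx 0 (Ordinal lt_e) *m invmx hankel.
pose u := rVpoly v.
have phi_uX (j : 'I_e) : phi (u * 'X^j) = (j == e.-1 :> nat)%:R.
  by rewrite phi_rVpoly mulmxKV // mxE eqxx.
have phi_u (q : {poly K}) : (size q <= e)%N -> phi (u * q) = q`_e.-1.
  move=> sq; rewrite (phi_poly _ sq) (bigD1 (Ordinal lt_e)) //= big1.
    by rewrite (phi_uX (Ordinal lt_e)) eqxx mulr1 addr0.
  by move=> j /negPf; rewrite -val_eqE /= => jN; rewrite phi_uX jN mulr0.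
have su : (size u <= e)%N by apply: size_poly.
have cop : coprimep g u.
  apply: contraT => cop; pose k : {poly K} := gcdp g u.
  have k0 : k != 0 by rewrite gcdp_eq0 negb_and g_neq0.
  have [g' Eg] : exists g' : {poly K}, g = g' * k by apply/dvdpP/dvdp_gcdl.
  have [u' Eu] : exists u' : {poly K}, u = u' * k by apply/dvdpP/dvdp_gcdr.
  have g'0 : g' != 0 by apply: contraNneq g_neq0 => g'0; rewrite Eg g'0 mul0r.
  have u0 : u != 0.
    apply/eqP => u0; have := phi_uX (Ordinal lt_e).
    by rewrite u0 mul0r linear0 eqxx => /eqP; rewrite eq_sym oner_eq0.
  have u'0 : u' != 0 by apply: contraNneq u0 => u'0; rewrite Eu u'0 mul0r.
  have [sg sk0] := size_mulE g'0 k0; rewrite -Eg size_g in sg.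
  have [su' _] := size_mulE u'0 k0; rewrite -Eu in su'.
  have sk1 : size k != 1%N by [].
  (* [f] has degree [e - 1], so [phi (u * f)] is its nonzero leading coefficient; but the common
     factor [k] makes [u * f] a multiple of [g], which [phi] kills. *)
  pose f := g' * 'X^(size k - 2).
  have sf : size f = e by rewrite size_mulXn //; lia.
  have := phi_u f; rewrite sf leqnn => /(_ isT) => phif.
  have : f`_e.-1 != 0 by rewrite -{1}sf -lead_coefE lead_coef_eq0 -size_poly_gt0 sf.
  rewrite -phif /f.
  have -> : u * (g' * 'X^(size k - 2)) = g * (u' * 'X^(size k - 2)).
    by rewrite [in LHS]Eu [in RHS]Eg mulrACA [RHS]mulrACA [u' * g']mulrC.
  by rewrite phi_g ?eqxx // size_mulXn //; lia.
exists u; split=> // [q sq|w sw phiw].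
  by rewrite phi_u; [move/leq_sizeP: sq => ->|lia].
have [[al be] /= /eqpP[[c1 c2] /= /andP[c10 c20] E]] := Bezoutp g u.
have [c c0 Ec] : exists2 c, c != 0 & gcdp g u = c%:P by apply/size_poly1P.
pose d := c1 / (c2 * c).
have Ebez1 : d *: (al * g + be * u) = 1.
  rewrite /d mulrC -scalerA E Ec -!mul_polyC -!polyCM mulVf //.
  by rewrite mulf_neq0.
have Ebez : d *: (be * u) = 1 - d *: (al * g).
  by rewrite -Ebez1 scalerDr addrAC subrr add0r.
(* [d *: be] inverts [u] modulo [g], so [u * q] and [w] agree modulo [g] and have the same value
   under [phi]. That value is the top coefficient of [q], hence [q] loses one degree. *)
pose q := (d *: (be * w)) %% g.
have sq : (size q <= e)%N by apply: size_modg.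
have uq_mod : (u * q) %% g = w %% g.
  rewrite modp_mul.
  have -> : u * (d *: (be * w)) = w - d *: (al * w) * g.
    have -> : u * (d *: (be * w)) = w * (d *: (be * u)).
      by rewrite -!mul_polyC; ring.
    by rewrite Ebez -!mul_polyC; ring.
  by rewrite modpD modpN modp_mull subr0.
have suq : (size (u * q)%R <= N.+1)%N by apply: size_mul_le.
have q0 : q`_e.-1 = 0 by rewrite -phi_u // phi_modp // uq_mod -phi_modp.
have sq' : (size q <= e.-1)%N.
  apply/leq_sizeP => j; rewrite leq_eqVlt => /orP[/eqP <- //|ej].
  by move/leq_sizeP: sq; apply; lia.
have [p Ep] : exists p : {poly K}, w - u * q = p * g.
  by apply/dvdpP; rewrite /dvdp modpD modpN uq_mod subrr.
have aux a b : (a + e.+1 = b + 1 -> b <= N.+1 -> a <= N.+1 - e)%N by lia.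
exists p, q; split=> //; last by rewrite mulrC -Ep subrK.
have [->|p0] := eqVneq p 0; first by rewrite size_poly0.
have : (size (p * g)%R <= N.+1)%N.
  rewrite -Ep; apply: leq_trans (size_polyD _ _) _.
  by rewrite geq_max sw size_polyN.
have [+ _] := size_mulE p0 g_neq0; rewrite size_g; apply: aux.
Qed.

End ApolarGenerators.

(** * Apolar forms and secant varieties *)

Lemma pchar0_natr_inj (R : idomainType) : [pchar R] =i pred0 ->
  injective (fun n => n%:R : R).
Proof.
move=> /pcharf0P R0 m n.
wlog mn : m n / (m <= n)%N.
  by move=> H; case/orP: (leq_total m n) => ? E; [|symmetry]; apply: H.
move/eqP; rewrite eq_sym -subr_eq0 -natrB // R0 subn_eq0 => nm.
by apply/eqP; rewrite eqn_leq mn.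
Qed.

Lemma polyP_infinite (K : closedFieldType) (p : {poly K}) :
  (forall x, p.[x] = 0) -> p = 0.
Proof.
move=> p0; have : size (p + 1) == 1%N.
  apply: contraT => /closed_rootP[x].
  by rewrite /root hornerD p0 hornerC add0r oner_eq0.
case/size_poly1P => c _ Ec.
have Ep : p = (c - 1)%:P by rewrite polyCB -Ec addrK.
by move: (p0 0); rewrite Ep hornerC => ->.
Qed.

Lemma polyP_cofinite (K : closedFieldType) (d p q : {poly K}) : d != 0 ->
  (forall x, d.[x] != 0 -> p.[x] = q.[x]) -> p = q.
Proof.
move=> d0 E; apply/eqP; rewrite -subr_eq0; apply/eqP.
suff : d * (p - q) = 0 by move/eqP; rewrite mulf_eq0 (negPf d0) => /eqP.
apply: polyP_infinite => x; rewrite hornerM hornerD hornerN.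
have [->|dx] := eqVneq d.[x] 0; first by rewrite mul0r.
by rewrite E // subrr mulr0.
Qed.

Section RowFunctional.

Variables (K : fieldType) (m : nat).
Implicit Types (a : 'rV[K]_m) (f : {poly K}).

Definition row_functional a f : K := \sum_(i < m) a 0 i * f`_i.

Lemma row_functional_is_scalar a : scalar (row_functional a).
Proof.
move=> c f f'; rewrite /row_functional mulr_sumr -big_split.
by apply: eq_bigr => i _; rewrite coefD coefZ mulrDr mulrCA.
Qed.

HB.instance Definition _ a :=
  GRing.isSemilinear.Build K {poly K} K _ (row_functional a)
    (GRing.semilinear_linear (row_functional_is_scalar a)).

Lemma row_functionalXn a (i : 'I_m) : row_functional a 'X^i = a 0 i.
Proof.
rewrite /row_functional (bigD1 i) //= coefXn eqxx mulr1 big1 ?addr0 // => j.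
by rewrite -val_eqE /= => jNi; rewrite coefXn (negPf jNi) mulr0.
Qed.

(* [apolar a e g]: the form of degree [e] with dehomogenization [g] annihilates
   the functional [a] on forms of degree [m - 1]. *)
Definition apolar a e (g : {poly K}) : Prop :=
  forall q : {poly K}, (size q + e <= m)%N -> row_functional a (g * q) = 0.

End RowFunctional.

Section Curve.

Variables (K : closedFieldType) (N : nat).
Notation RNC := (@rational_normal_curve K N).

Definition curve_automorphism (M : 'M[K]_N.+1) : Prop :=
  M \in unitmx /\ forall x, RNC x <-> RNC (x *m M).

Lemma curve_automorphism1 : curve_automorphism 1%:M.
Proof. by split=> [|x]; rewrite ?unitmx1 ?mulmx1. Qed.

Lemma RNC_affine (b : K) : RNC (veronese_point N 1 b).
Proof. exists 1, b; split; last by apply/eqmxP.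
by apply/eqP => -[/eqP]; rewrite oner_eq0. Qed.

Lemma veronese_neq0 (s t : K) : (s, t) != (0, 0) -> veronese_point N s t != 0.
Proof.
move=> st; apply/eqP => /rowP V.
have := V ord0; have := V ord_max; rewrite !mxE /= subn0 subnn expr0 mul1r mulr1.
move/eqP; rewrite expf_eq0 => /andP[_ /eqP t0] /eqP; rewrite expf_eq0 => /andP[_ /eqP s0].
by rewrite s0 t0 eqxx in st.
Qed.

Lemma row_eqmx_scale (x y : 'rV[K]_N.+1) : (x == y)%MS -> x != 0 ->
  exists2 c, c != 0 & x = c *: y.
Proof.
case/andP=> /sub_rVP[c Ex] _ x0; exists c => //.
by apply: contraNneq x0 => c0; rewrite Ex c0 scale0r.
Qed.

Lemma row_eqmx0 (x y : 'rV[K]_N.+1) : (x == y)%MS -> (x == 0) = (y == 0).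
Proof. by move/eqmxP => E; rewrite -!submx0 E. Qed.

(** * From an apolar form of degree e to the e-th join *)

Section Join.

Variables (e : nat) (b : 'I_e -> K) (a : 'rV[K]_N.+1).
Hypothesis e_le : (e <= N.+1)%N.
Let g : {poly K} := \prod_i ('X - (b i)%:P).
Hypothesis a_g : apolar a e g.

(* The roots of [g] are moved apart along the lines [b i + i * eps], and [a]
   is deformed with its first [e] coordinates fixed. *)
Let root_line (i : 'I_e) : {poly K} := (b i)%:P + (i%:R : K) *: 'X.
Let G : {poly {poly K}} := \prod_i ('X - (root_line i)%:P).
Let rem n : {poly {poly K}} := Pdiv.CommonRing.rmodp 'X^n G.

(** Apolarity to [g] means that the coordinates of [a] satisfy the linear recurrence with
    characteristic polynomial [g]. This is the solution of the recurrence of [G] with the same [e]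
    initial values, as a polynomial in the parameter. *)
Definition deformation n : {poly K} :=
  \sum_(j < e) (a 0 (widen_ord e_le j))%:P * (rem n)`_j.

Let at_eps (x : K) : {poly {poly K}} -> {poly K} := map_poly (horner_eval x).

Let G_monic : G \is monic.
Proof. exact: monic_prod_XsubC. Qed.

Let size_G : size G = e.+1.
Proof. by rewrite size_prod_XsubC /index_enum -enumT size_enum_ord. Qed.

Let size_rem n : (size (rem n) <= e)%N.
Proof. by rewrite -ltnS -size_G Pdiv.CommonRing.ltn_rmodp monic_neq0. Qed.

Let at_eps_G x : at_eps x G = \prod_i ('X - (root_line i).[x]%:P).
Proof.
rewrite /at_eps rmorph_prod; apply: eq_bigr => i _.
by rewrite rmorphB /= map_polyX map_polyC.
Qed.

Let at_eps_rem x n : exists q, 'X^n = q * at_eps x G + at_eps x (rem n).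
Proof.
exists (at_eps x (Pdiv.CommonRing.rdivp 'X^n G)).
by rewrite /at_eps -rmorphM -rmorphD -Pdiv.RingMonic.rdivp_eq //= map_polyXn.
Qed.

Let size_at_eps_rem x n : (size (at_eps x (rem n)) <= e)%N.
Proof. by apply: leq_trans (size_poly _ _) (size_rem n). Qed.

Lemma deformation_horner x n : (deformation n).[x] =
  \sum_(j < e) a 0 (widen_ord e_le j) * (at_eps x (rem n))`_j.
Proof.
rewrite horner_sum; apply: eq_bigr => j _.
by rewrite hornerM hornerC coef_map.
Qed.

Lemma deformation0 (n : 'I_N.+1) : (deformation n).[0] = a 0 n.
Proof.
have [q] := at_eps_rem 0 n.
have -> : at_eps 0 G = g.
  by rewrite at_eps_G; apply: eq_bigr => i _; rewrite /root_line !hornerE.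
rewrite deformation_horner; set R := at_eps 0 (rem n) => E.
have sR : (size R <= e)%N by apply: size_at_eps_rem.
have g_monic : g \is monic by apply: monic_prod_XsubC.
have sg : size g = e.+1 by rewrite size_prod_XsubC /index_enum -enumT size_enum_ord.
have sq : (size q + e <= N.+1)%N.
  have [->|q0] := eqVneq q 0; first by rewrite size_poly0.
  have : (size (q * g)%R <= N.+1)%N.
    have -> : q * g = 'X^n - R by rewrite E addrK.
    apply: leq_trans (size_polyD _ _) _; rewrite size_polyN size_polyXn geq_max.
    by rewrite ltn_ord (leq_trans sR).
  by rewrite size_Mmonic // sg addnS.
rewrite -row_functionalXn E linearD /= mulrC a_g // add0r.
rewrite /row_functional (bigID (fun i : 'I_N.+1 => (i < e)%N)) /= [X in _ = _ + X]big1.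
  by rewrite addr0 big_ord_narrow.
by move=> i; rewrite -leqNgt => ei; move/leq_sizeP: sR => ->; rewrite ?mulr0.
Qed.

Lemma deformation_small x n (ne : (n < e)%N) :
  (deformation n).[x] = a 0 (widen_ord e_le (Ordinal ne)).
Proof.
have remE : rem n = 'X^n.
  by rewrite /rem Pdiv.CommonRing.rmodp_small // size_polyXn size_G ltnS.
rewrite deformation_horner remE (bigD1 (Ordinal ne)) //= big1.
  by rewrite /at_eps map_polyXn coefXn eqxx mulr1 addr0.
move=> j; rewrite -val_eqE /= => jNn.
by rewrite /at_eps map_polyXn coefXn (negPf jNn) mulr0.
Qed.

Hypothesis charK0 : [pchar K] =i pred0.

Let discr : {poly K} := \prod_i \prod_(j | j != i) (root_line i - root_line j).

(** The coefficient of the parameter in [root_line i - root_line j] is [i - j], which is nonzero in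
    characteristic 0. *)
Let discr_neq0 : discr != 0.
Proof.
apply/prodf_neq0 => i _; apply/prodf_neq0 => j; apply: contraNneq => E.
have := congr1 (fun p : {poly K} => p`_1) E.
rewrite /root_line coef0 !coefE /= !add0r !mulr1 => /eqP.
rewrite subr_eq0 => /eqP Eij.
by rewrite eq_sym -val_eqE; apply/eqP; apply: (pchar0_natr_inj charK0).
Qed.

Let root_line_inj x : discr.[x] != 0 -> injective (fun i => (root_line i).[x]).
Proof.
move=> dx i j /eqP; rewrite -subr_eq0 => /eqP E; apply/eqP; apply: contraNT dx => ij.
rewrite horner_prod (bigD1 i) //= horner_prod (bigD1 j) 1?eq_sym //=.
by rewrite hornerD hornerN E !mul0r.
Qed.

(** When the roots are distinct, a solution of the recurrence is a combination of geometric
    progressions, which are points of the curve. Inverting a Vandermonde matrix finds the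
    combination from the first [e] coordinates. *)
Lemma deformation_in_span (M : 'M[K]_N.+1) x : curve_automorphism M ->
  a != 0 -> discr.[x] != 0 ->
  in_spanned_subspace RNC e ((\row_n (deformation n).[x]) *m M).
Proof.
move=> [Munit MC] a0 /root_line_inj beta_inj; set v := \row_n _.
pose beta i := (root_line i).[x].
split.
  apply/eqP => vM0; case/eqP: a0; apply/rowP => n.
  have v0 : v = 0 by rewrite -[v](mulmxK Munit) vM0 mul0mx.
  rewrite mxE -deformation0 deformation_horner big1 // => j _.
  have := congr1 (fun u : 'rV_N.+1 => u 0 (widen_ord e_le j)) v0.
  rewrite !mxE (deformation_small x (ltn_ord j)) => E.
  by rewrite (_ : widen_ord _ _ = widen_ord e_le (Ordinal (ltn_ord j))) ?E ?mul0r //; apply: val_inj.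
pose V : 'M[K]_(e, N.+1) := \matrix_i veronese_point N 1 (beta i).
pose Ve : 'M[K]_e := (Vandermonde e (\row_i beta i))^T.
have VeE i j : Ve i j = beta i ^+ j by rewrite !mxE.
have VE i j : V i j = beta i ^+ j by rewrite !mxE expr1n mul1r.
have Ve_unit : Ve \in unitmx.
  rewrite unitmx_tr unitmxE det_Vandermonde unitfE.
  apply/prodf_neq0 => i _; apply/prodf_neq0 => j; apply: contraTneq => /eqP.
  by rewrite !mxE subr_eq0 (inj_eq beta_inj) => /eqP->; rewrite ltnn.
exists (V *m M); split.
- by move=> i; rewrite row_mul rowK; apply: (MC _).1; apply: RNC_affine.
- rewrite /row_free mxrankMfree ?row_free_unit // -/(row_free V).
  apply: inj_row_free => u uV; rewrite -[u](mulmxK Ve_unit).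
  suff -> : u *m Ve = 0 by rewrite mul0mx.
  apply/rowP => j; have := congr1 (fun u : 'rV_N.+1 => u 0 (widen_ord e_le j)) uV.
  rewrite !mxE => E; rewrite -[RHS]E; apply: eq_bigr => i _.
  by rewrite VeE VE.
apply: submxMr; apply/submxP.
pose c : 'rV[K]_e := \row_j a 0 (widen_ord e_le j).
exists (c *m invmx Ve); apply/rowP => n; rewrite !mxE deformation_horner.
pose R := at_eps x (rem n).
have betaE i : beta i ^+ n = \sum_(j < e) R`_j * beta i ^+ j.
  have [q E] := at_eps_rem x n.
  rewrite -horner_coef_wide ?size_at_eps_rem // -hornerXn E hornerD hornerM.
  have -> : (at_eps x G).[beta i] = 0; last by rewrite mulr0 add0r.
  by rewrite at_eps_G horner_prod (bigD1 i) //= hornerXsubC subrr mul0r.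
transitivity (\sum_i (c *m invmx Ve) 0 i * \sum_(j < e) R`_j * beta i ^+ j).
  under [RHS]eq_bigr => i _ do rewrite mulr_sumr.
  rewrite exchange_big; apply: eq_bigr => j _ /=.
  have -> : a 0 (widen_ord e_le j) = (c *m invmx Ve *m Ve) 0 j by rewrite mulmxKV // mxE.
  rewrite mxE mulr_suml; apply: eq_bigr => i _.
  by rewrite VeE -/R; ring.
by apply: eq_bigr => i _; rewrite -betaE VE.
Qed.

(** Along the deformation, a form vanishing on the spanned subspaces is a polynomial in the
    parameter that vanishes wherever [discr] does not. It is therefore zero, also at the parameter
    0, where the deformation is [a]. *)
Lemma apolar_self_join (M : 'M[K]_N.+1) : curve_automorphism M -> a != 0 ->
  self_join RNC e (a *m M).
Proof.
move=> Maut a0; split.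
  by apply: contraNneq a0 => aM0; rewrite -[a](mulmxK Maut.1) aM0 mul0mx.
move=> f _ fX.
pose h (k : 'I_N.+1) : {poly K} := \sum_(n < N.+1) deformation n * (M n k)%:P.
have hE x : (mmap (@polyC K) h f).[x] = eval_at f ((\row_n (deformation n).[x]) *m M).
  rewrite /eval_at [in LHS]/mmap horner_sum mevalE; apply: eq_bigr => m _.
  rewrite hornerM hornerC /mmap1 horner_prod; congr (_ * _); apply: eq_bigr => k _.
  rewrite horner_exp; congr (_ ^+ _); rewrite /h horner_sum mxE.
  by apply: eq_bigr => n _; rewrite hornerM hornerC mxE.
have h0 : mmap (@polyC K) h f = 0.
  apply: (polyP_cofinite discr_neq0) => x dx.
  by rewrite hE horner0 fX //; apply: deformation_in_span.
have := hE 0; rewrite h0 horner0 (_ : \row_n _ = a) //.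
by apply/rowP => n; rewrite mxE deformation0.
Qed.

End Join.
End Curve.

(** * Reparametrization of the curve *)

Lemma is_least_exists (P : nat -> Prop) : (exists n, P n) -> exists n, is_least P n.
Proof.
case=> n; elim/ltn_ind: n => n IH Pn.
have [[m [mn Pm]]|noP] := classic (exists m, (m < n)%N /\ P m); first exact: IH Pm.
exists n; split=> // m Pm; rewrite leqNgt; apply/negP => mn.
by apply: noP; exists m.
Qed.

Section Inversion.

Variables (K : closedFieldType) (c : K).

(* The form of degree [n] with dehomogenization [f] in the coordinate [y] has
   this dehomogenization in the coordinate [x] with [y = c + 1 / x]. *)
Definition inversion_poly n (f : {poly K}) : {poly K} :=
  \sum_(i < n.+1) f`_i *: ('X^(n - i) * (c *: 'X + 1) ^+ i).

Lemma horner_inversion n (f : {poly K}) x : (size f <= n.+1)%N -> x != 0 ->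
  (inversion_poly n f).[x] = x ^+ n * f.[c + x^-1].
Proof.
move=> sf x0; rewrite horner_sum (horner_coef_wide _ sf) mulr_sumr.
apply: eq_bigr => i _; rewrite !hornerE.
have -> : c * x + 1 = x * (c + x^-1) by rewrite mulrDr mulfV // mulrC.
rewrite /= -mulrA exprMn [x ^+ (n - i) * _]mulrA -exprD subnK; last by rewrite -ltnS.
by rewrite mulrCA mulrA.
Qed.

Lemma size_linear_exp i : (size ((c *: 'X + 1 : {poly K}) ^+ i)%R <= i.+1)%N.
Proof.
apply: leq_trans (size_poly_exp_leq _ _) _.
have : (size (c *: 'X + 1 : {poly K})%R <= 2)%N.
  apply: leq_trans (size_polyD _ _) _; rewrite size_poly1 geq_max andbT.
  by apply: leq_trans (size_scale_leq _ _) _; rewrite size_polyX.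
by case: (size _) => [|[|[|]]] //=; rewrite ?mul1n ?mul0n.
Qed.

Lemma coef_linear_exp i : ((c *: 'X + 1 : {poly K}) ^+ i)`_i = c ^+ i.
Proof.
elim: i => [|i IH]; first by rewrite !expr0 coef1.
rewrite exprS mulrDl mul1r -scalerAl coefD coefZ coefXM /= IH -exprS.
by move/leq_sizeP: (size_linear_exp i) => ->; rewrite ?addr0.
Qed.

Lemma size_inversion_monomial n i : (i <= n)%N ->
  (size ('X^(n - i) * (c *: 'X + 1) ^+ i : {poly K})%R <= n.+1)%N.
Proof.
move=> i_n; apply: leq_trans (size_polyMleq _ _) _; rewrite size_polyXn.
have aux a : (a <= i.+1 -> ((n - i).+1 + a).-1 <= n.+1)%N by lia.
exact: aux (size_linear_exp i).
Qed.

Lemma coef_inversion_monomial n i : (i <= n)%N ->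
  ('X^(n - i) * (c *: 'X + 1) ^+ i : {poly K})`_n = c ^+ i.
Proof.
by move=> i_n; rewrite coefXnM ltnNge leq_subr /= subKn // coef_linear_exp.
Qed.

Lemma size_inversion n (f : {poly K}) : (size (inversion_poly n f) <= n.+1)%N.
Proof.
apply: leq_trans (size_sum _ _ _) _; apply/bigmax_leqP => i _.
apply: leq_trans (size_scale_leq _ _) (size_inversion_monomial _).
by rewrite -ltnS.
Qed.

Lemma coef_inversion n (f : {poly K}) : (size f <= n.+1)%N -> (inversion_poly n f)`_n = f.[c].
Proof.
move=> sf; rewrite (horner_coef_wide _ sf) coef_sum; apply: eq_bigr => i _.
by rewrite coefZ coef_inversion_monomial // -ltnS.
Qed.

(** This transports apolarity between the two coordinates: up to the common denominator, the test
    monomial [x^l] of a form of degree [m] is [(y - c)^(m - l)]. *)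
Lemma inversion_mulXn n m (f : {poly K}) l : (size f <= n.+1)%N -> (l <= m)%N ->
  inversion_poly (n + m) (f * ('X - c%:P) ^+ (m - l)) = inversion_poly n f * 'X^l.
Proof.
move=> sf lm; have X0 : 'X != 0 :> {poly K} by rewrite polyX_eq0.
apply: (polyP_cofinite X0) => x; rewrite hornerX => x0.
rewrite hornerM horner_inversion //; last first.
  by apply: leq_trans (size_polyMleq _ _) _; rewrite size_exp_XsubC; lia.
rewrite horner_inversion // !hornerE [c + x^-1 - c]addrAC subrr add0r.
have -> : x ^+ (n + m) = x ^+ n * x ^+ l * x ^+ (m - l).
  by rewrite -!exprD; congr (_ ^+ _); lia.
have : x ^+ (m - l) * x^-1 ^+ (m - l) = 1 by rewrite -exprMn mulfV // expr1n.
by move=> E; rewrite -[RHS]mulr1 -E /=; ring.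
Qed.

Variable N : nat.

Definition inversion_mx : 'M[K]_N.+1 :=
  \matrix_(j, i) ('X^(N - i) * (c *: 'X + 1) ^+ i : {poly K})`_j.

Lemma veronese_inversion (s t : K) :
  veronese_point N s t *m inversion_mx = veronese_point N t (c * t + s).
Proof.
apply/rowP => i; rewrite !mxE.
have iN : (i <= N)%N by rewrite -ltnS.
set f : {poly K} := 'X^(N - i) * (c *: 'X + 1) ^+ i.
have sf : (size f <= N.+1)%N by apply: size_inversion_monomial.
have [->|s0] := eqVneq s 0.
  rewrite (bigD1 ord_max) //= big1 ?addr0 => [|j jN].
    rewrite !mxE subnn mul1r coef_inversion_monomial // exprMn.
    by rewrite mulrCA -exprD subnK // mulrC.
  have jlt : (j < N)%N by rewrite ltn_neqAle -ltnS ltn_ord andbT; apply: jN.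
  by rewrite !mxE expr0n subn_eq0 leqNgt jlt !mul0r.
transitivity (s ^+ N * f.[t / s]).
  rewrite (horner_coef_wide _ sf) mulr_sumr; apply: eq_bigr => j _; rewrite !mxE -/f.
  have -> : s ^+ N = s ^+ (N - j) * s ^+ j by rewrite -exprD subnK // -ltnS.
  by rewrite exprMn exprVn; field; apply: expf_neq0.
have -> : s ^+ N = s ^+ (N - i) * s ^+ i by rewrite -exprD subnK.
rewrite !hornerE /=.
transitivity ((s * (t / s)) ^+ (N - i) * (s * (c * t / s + 1)) ^+ i).
  by rewrite ![(s * _) ^+ _]exprMn; ring.
by congr (_ ^+ _ * _ ^+ _); field.
Qed.

Hypothesis charK0 : [pchar K] =i pred0.

(** The points of parameters 0, ..., [N] are images of the points [(i - c : 1)], so the matrix is a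
    factor of a Vandermonde matrix with distinct nodes. *)
Lemma inversion_mx_unit : inversion_mx \in unitmx.
Proof.
pose V : 'M[K]_N.+1 := \matrix_(i < N.+1) veronese_point N 1 i%:R.
have V_unit : V \in unitmx.
  have -> : V = (Vandermonde N.+1 (\row_(i < N.+1) i%:R))^T.
    by apply/matrixP => i j; rewrite !mxE expr1n mul1r.
  rewrite unitmx_tr unitmxE det_Vandermonde unitfE.
  apply/prodf_neq0 => i _; apply/prodf_neq0 => j; apply: contraTneq => /eqP.
  rewrite !mxE subr_eq0 => /eqP/(pchar0_natr_inj charK0) ->.
  by rewrite ltnn.
have VE : V = (\matrix_(i < N.+1) veronese_point N (i%:R - c) 1) *m inversion_mx.
  by apply/row_matrixP => i; rewrite row_mul !rowK veronese_inversion mulr1 addrC subrK.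
by move: V_unit; rewrite VE unitmx_mul => /andP[].
Qed.

Lemma inversion_curve_automorphism : curve_automorphism inversion_mx.
Proof.
have Munit := inversion_mx_unit.
split=> // x; split=> -[s [t [st /eqmxP xst]]].
  exists t, (c * t + s); split.
    apply: contraNneq st => -[-> ]; rewrite mulr0 add0r => ->; exact: eqxx.
  by apply/eqmxP; rewrite -veronese_inversion; apply: eqmxMr.
exists (t - c * s), s; split.
  apply: contraNneq st => -[+ s0]; rewrite s0 mulr0 subr0 => ->; exact: eqxx.
apply/eqmxP; apply: (@eqmxMfree _ _ _ _ _ _ _ inversion_mx).
  by rewrite row_free_unit.
by rewrite veronese_inversion addrC subrK.
Qed.

Lemma row_functional_inversion (a : 'rV[K]_N.+1) h :
  row_functional (a *m inversion_mx) h = row_functional a (inversion_poly N h).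
Proof.
rewrite linear_sum /row_functional; apply: eq_bigr => i _ /=.
rewrite linearZ /= mulrC mxE; congr (_ * _).
by apply: eq_bigr => j _; rewrite mxE.
Qed.

End Inversion.

(** For [N < 2 * e] the catalecticant [H] has more rows than columns, so some row vector is killed
    by it. *)
Lemma apolar_form_exists (K : fieldType) N (p : 'rV[K]_N.+1) e :
  (e <= N.+1)%N -> (N < 2 * e)%N -> exists g : {poly K},
    [/\ g != 0, (size g <= e.+1)%N & apolar p e g].
Proof.
move=> eN Ne; pose H : 'M[K]_(e.+1, N.+1 - e) :=
  \matrix_(i, j) row_functional p 'X^(i + j).
have : kermx H != 0.
  rewrite kermx_eq0; apply/negP => /eqP rH.
  by have := rank_leq_col H; rewrite rH; lia.
case/rowV0Pn => v /sub_kermxP vH v0; exists (rVpoly v); split.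
- by apply: contraNneq v0 => v0; rewrite -[v]rVpolyK v0 linear0.
- exact: size_poly.
move=> q sq; have {}sq : (size q <= N.+1 - e)%N by lia.
rewrite (poly_sum_bound sq) mulr_sumr linear_sum big1 // => j _.
rewrite -scalerAr linearZ /= (poly_sum_bound (size_poly _ _ : size (rVpoly v) <= e.+1)%N).
rewrite mulr_suml linear_sum [X in _ * X]/= (_ : \sum_i _ = (v *m H) 0 j).
  by rewrite vH mxE mulr0.
rewrite mxE; apply: eq_bigr => i _; rewrite -scalerAl linearZ /= -exprD mxE.
by rewrite coef_rVpoly_ord.
Qed.

Lemma apolar_chart (K : closedFieldType) N (p : 'rV[K]_N.+1) :
  [pchar K] =i pred0 -> (0 < N)%N -> exists (M : 'M[K]_N.+1) (a : 'rV[K]_N.+1) e g,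
    [/\ curve_automorphism M, p = a *m M, (2 * e <= N + 2)%N &
        [/\ g \is monic, size g = e.+1 & apolar a e g]].
Proof.
(* The smallest degree at which the catalecticant is forced to have a kernel; it still satisfies
   [2 * e <= N + 2]. *)
move=> charK0 N_gt0; pose e := N./2.+1.
have eN : (2 * e <= N + 2)%N by rewrite /e; lia.
have [g [g0 sg pg]] : exists g : {poly K},
    [/\ g != 0, (size g <= e.+1)%N & apolar p e g].
  by apply: apolar_form_exists; rewrite /e; lia.
(* The value of [g] at [c] becomes the top coefficient in the new coordinate, so a non-root [c]
   leaves no root at infinity. *)
have [c gc] : exists c, g.[c] != 0.
  apply: NNPP => ng; case/eqP: g0; apply: polyP_infinite => x.
  by apply/eqP/negPn/negP => gx; apply: ng; exists x.
pose g' := g.[c]^-1 *: inversion_poly c e g.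
have Munit := inversion_mx_unit c N charK0.
pose a := p *m invmx (inversion_mx c N).
exists (inversion_mx c N), a, e, g'.
have pE : p = a *m inversion_mx c N by rewrite mulmxKV.
have sg' : size g' = e.+1.
  apply/eqP; rewrite eqn_leq; apply/andP; split.
    by apply: leq_trans (size_scale_leq _ _) (size_inversion _ _ _).
  rewrite ltnNge; apply/negP => /leq_sizeP/(_ e (leqnn _))/eqP.
  by rewrite coefZ coef_inversion // mulVf // oner_eq0.
split=> //; first exact: inversion_curve_automorphism.
split=> //.
  by rewrite monicE lead_coefE sg' /= coefZ coef_inversion // mulVf.
move=> q sq; have {}sq : (size q <= N.+1 - e)%N by lia.
rewrite (poly_sum_bound sq) mulr_sumr linear_sum big1 // => l _.
rewrite -scalerAr linearZ /= /g' -scalerAl linearZ /=.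
have l_le : (l <= N - e)%N by have := ltn_ord l; rewrite /e; lia.
rewrite -(inversion_mulXn c sg l_le) subnKC; last by rewrite /e; lia.
rewrite -row_functional_inversion -pE pg ?mulr0 // size_exp_XsubC /e; lia.
Qed.

(** * Quadrics of rank 4 *)

Lemma eval_at_scale (K : fieldType) n d (f : {mpoly K[n]}) c x :
  f \is d.-homog -> eval_at f (c *: x) = c ^+ d * eval_at f x.
Proof.
move=> hf; rewrite /eval_at !mevalE mulr_sumr big_seq [RHS]big_seq.
apply: eq_bigr => m mf; rewrite mulrCA; congr (_ * _).
under eq_bigr => i _ do rewrite mxE exprMn.
by rewrite big_split /= prodrXr -mdegE (dhomog_mf hf mf).
Qed.

Section CurveImage.

Variables (K : closedFieldType) (N n : nat).
Notation RNC := (@rational_normal_curve K N).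
Variable B : 'M[K]_(N.+1, n).

Definition coordinate_poly j : {poly K} := rVpoly (row j B^T).

Definition curve_ev : {mpoly K[n]} -> {poly K} := mmap (@polyC K) coordinate_poly.

Lemma horner_coordinate_poly b j :
  (coordinate_poly j).[b] = (veronese_point N 1 b *m B) 0 j.
Proof.
rewrite (horner_coef_wide _ (size_poly _ _)) mxE; apply: eq_bigr => i _.
by rewrite coef_rVpoly_ord !mxE expr1n mul1r mulrC.
Qed.

Lemma horner_curve_ev f b :
  (curve_ev f).[b] = eval_at f (veronese_point N 1 b *m B).
Proof.
rewrite /eval_at mevalE [in LHS]/curve_ev /mmap horner_sum; apply: eq_bigr => m _.
rewrite hornerM hornerC /mmap1 horner_prod; congr (_ * _); apply: eq_bigr => k _.
by rewrite horner_exp horner_coordinate_poly.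
Qed.

Lemma curve_ev_vanishes d f : f \is d.-homog -> curve_ev f = 0 ->
  vanishes_on (projection_image B RNC) f.
Proof.
move=> hf evf y [_ [x [s [t [st xst]]] ->]].
have ev_s1 s' t' : s' != 0 -> eval_at f (veronese_point N s' t' *m B) = 0.
  move=> s0; have -> : veronese_point N s' t' = s' ^+ N *: veronese_point N 1 (t' / s').
    apply/rowP => i; rewrite !mxE expr1n mul1r exprMn exprVn.
    have -> : s' ^+ N = s' ^+ (N - i) * s' ^+ i by rewrite -exprD subnK // -ltnS.
    by field; apply: expf_neq0.
  by rewrite -scalemxAl (eval_at_scale _ _ hf) -horner_curve_ev evf horner0 mulr0.
have ev_st : eval_at f (veronese_point N s t *m B) = 0.
  have [s0|] := eqVneq s 0; last exact: ev_s1.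
  (* The point with [s = 0] has no affine parameter. Now [t] is fixed and [s] varies: a polynomial
     in [s] vanishing at all nonzero [s] vanishes at 0. *)
  pose h j : {poly K} := \sum_(i < N.+1) (t ^+ i * B i j) *: 'X^(N - i).
  have hE b : (mmap (@polyC K) h f).[b] = eval_at f (veronese_point N b t *m B).
    rewrite /eval_at mevalE [in LHS]/mmap horner_sum; apply: eq_bigr => m _.
    rewrite hornerM hornerC /mmap1 horner_prod; congr (_ * _); apply: eq_bigr => k _.
    rewrite horner_exp /h horner_sum mxE; congr (_ ^+ _); apply: eq_bigr => i _.
    by rewrite hornerZ hornerXn mxE; ring.
  have X0 : 'X != 0 :> {poly K} by rewrite polyX_eq0.
  have h0 : mmap (@polyC K) h f = 0.
    apply: (polyP_cofinite X0) => b; rewrite hornerX => b0.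
    by rewrite hE horner0 ev_s1.
  by rewrite s0 -hE h0 horner0.
have x0 : x != 0 by rewrite (row_eqmx0 xst) veronese_neq0.
have [c _ ->] := row_eqmx_scale xst x0.
by rewrite -scalemxAl (eval_at_scale _ _ hf) ev_st mulr0.
Qed.

Lemma vanishes_curve_ev f : (exists j, coordinate_poly j != 0) ->
  vanishes_on (projection_image B RNC) f -> curve_ev f = 0.
Proof.
case=> j wj fX; apply: (polyP_cofinite wj) => b wb; rewrite horner0 horner_curve_ev.
apply: fX; split; last by exists (veronese_point N 1 b) => //; apply: RNC_affine.
apply: contraNneq wb; rewrite horner_coordinate_poly => ->.
by rewrite mxE.
Qed.

(** The pseudo-inverse makes this linear on all polynomials; it is a section of [curve_ev] only on
    the hyperplane of [curve_ev_lift]. *)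
Definition lift_form (u : {poly K}) : {mpoly K[n]} :=
  linform (poly_rV u *m pinvmx B^T).

Lemma lift_form_is_linear : linear lift_form.
Proof.
by move=> c u v; rewrite /lift_form linearP mulmxDl -scalemxAl linformD linformZ.
Qed.

HB.instance Definition _ :=
  GRing.isSemilinear.Build K {poly K} {mpoly K[n]} _ lift_form
    (GRing.semilinear_linear lift_form_is_linear).

Lemma curve_ev_linform c : curve_ev (linform c) = rVpoly (c *m B^T).
Proof.
rewrite /linform /curve_ev raddf_sum /= mulmx_sum_row linear_sum.
by apply: eq_bigr => i _ /=; rewrite mmapZ mmapX mmap1U mul_polyC linearZ.
Qed.

End CurveImage.

Lemma projection_image_automorphism (K : closedFieldType) N n (M : 'M[K]_N.+1)
    (A : 'M[K]_(N.+1, n)) y : curve_automorphism M ->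
  projection_image (M *m A) (@rational_normal_curve K N) y <->
  projection_image A (@rational_normal_curve K N) y.
Proof.
move=> [Munit MC]; split=> -[y0 [x xC yE]]; split=> //.
  by exists (x *m M); [apply: (MC x).1 | rewrite -mulmxA].
exists (x *m invmx M); last by rewrite mulmxA mulmxKV.
by apply: (MC _).2; rewrite mulmxKV.
Qed.

(** * Quadrics containing the curve projected from a point *)

Section PointProjection.

Variables (K : closedFieldType) (N : nat).
Notation RNC := (@rational_normal_curve K N).
Variables (B : 'M[K]_(N.+1, N)) (a : 'rV[K]_N.+1).
Hypothesis a_neq0 : a != 0.
Hypothesis kerB : (kermx B == a)%MS.
Let X := projection_image B RNC.

Definition hyperplane_form (u : {poly K}) : Prop :=
  (size u <= N.+1)%N /\ row_functional a u = 0.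

Let aB0 : a *m B = 0.
Proof. by apply/sub_kermxP; case/andP: kerB. Qed.

Let rankB : \rank B = N.
Proof.
have := mxrank_ker B; have := eqmx_rank kerB; rewrite rank_rV a_neq0 => -> /=.
by have := rank_leq_row B; lia.
Qed.

Let freeBT : row_free B^T.
Proof. by rewrite /row_free mxrank_tr rankB. Qed.

Let hyperplane_sub u : hyperplane_form u -> (poly_rV u <= B^T)%MS.
Proof.
case=> su au.
have BT_le : (B^T <= kermx a^T)%MS by apply/sub_kermxP; rewrite -trmx_mul aB0 trmx0.
have : (kermx a^T <= B^T)%MS.
  rewrite -(geq_leqif (mxrank_leqif_sup BT_le)) mxrank_ker !mxrank_tr rankB.
  by rewrite rank_rV a_neq0 subn1.
apply: submx_trans; apply/sub_kermxP/matrixP => i j; rewrite !ord1 mxE.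
transitivity (row_functional a u); last by rewrite au mxE.
by apply: eq_bigr => k _; rewrite !mxE mulrC.
Qed.

Lemma curve_ev_lift u : hyperplane_form u -> curve_ev B (lift_form B u) = u.
Proof.
move=> Wu; rewrite curve_ev_linform mulmxKpV ?hyperplane_sub //.
by rewrite poly_rV_K //; case: Wu.
Qed.

Lemma lift_coordinate_poly j : lift_form B (coordinate_poly B j) = 'X_j.
Proof. by rewrite /lift_form rVpolyK -row_mul mulmxVp // row1 linform_delta. Qed.

Lemma coordinate_poly_hyperplane j : hyperplane_form (coordinate_poly B j).
Proof.
split; first exact: size_poly.
have := congr1 (fun v : 'rV_N => v 0 j) aB0; rewrite mxE [X in _ = X]mxE => <-.
by apply: eq_bigr => i _; rewrite coef_rVpoly_ord !mxE.
Qed.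

Hypothesis N_gt0 : (0 < N)%N.

Lemma coordinate_poly_neq0 : exists j, coordinate_poly B j != 0.
Proof.
exists (Ordinal N_gt0); apply/eqP => w0.
have := lift_coordinate_poly (Ordinal N_gt0).
rewrite w0 linear0 => /(congr1 (mcoeff U_(Ordinal N_gt0)%MM)).
by rewrite mcoeff0 mcoeffXU eqxx => /esym/eqP; rewrite oner_eq0.
Qed.

Lemma vanishes_onP d f : f \is d.-homog -> vanishes_on X f <-> curve_ev B f = 0.
Proof.
move=> hf; split; first exact/vanishes_curve_ev/coordinate_poly_neq0.
exact: curve_ev_vanishes hf.
Qed.

Definition quadrics_of_rank k (q : {mpoly K[N]}) : Prop :=
  [/\ q \is 2.-homog, (quadric_rank q <= k)%N & vanishes_on X q].

Lemma curve_ev_ideal : ideal_pred (fun f => curve_ev B f = 0).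
Proof.
split; rewrite /curve_ev; first exact: rmorph0.
  by move=> f g f0 g0; rewrite rmorphD /= f0 g0 addr0.
by move=> c f f0; rewrite rmorphM /= f0 mulr0.
Qed.

Lemma quadrics_of_rank_ev k f : ideal_gen (quadrics_of_rank k) f -> curve_ev B f = 0.
Proof.
apply: (ideal_gen_least (J := fun f => curve_ev B f = 0) curve_ev_ideal).
by move=> g [hg _ gX]; apply/(vanishes_onP hg).
Qed.

Hypothesis charK0 : [pchar K] =i pred0.

Let two_neq0 : 2%:R != 0 :> K.
Proof. by have /pcharf0P-> := charK0. Qed.

Lemma quadric4_in_ideal u1 u2 u3 u4 : hyperplane_form u1 -> hyperplane_form u2 ->
  hyperplane_form u3 -> hyperplane_form u4 -> u1 * u2 = u3 * u4 ->
  ideal_gen (quadrics_of_rank 4)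
    (lift_form B u1 * lift_form B u2 - lift_form B u3 * lift_form B u4).
Proof.
move=> W1 W2 W3 W4 E; apply: ideal_gen_incl.
have hq : lift_form B u1 * lift_form B u2 - lift_form B u3 * lift_form B u4 \is 2.-homog.
  by apply: rpredB; apply: linform_mul_homog.
split=> //.
  by apply: (@quadric_rankB _ _ _ _ 2 2); apply: quadric_rank_mul.
apply/(vanishes_onP hq); rewrite /curve_ev rmorphB !rmorphM /= -/(curve_ev B).
by rewrite !curve_ev_lift // E subrr.
Qed.

Lemma quadric3_in_ideal u1 u2 u3 : hyperplane_form u1 -> hyperplane_form u2 ->
  hyperplane_form u3 -> u1 * u2 = u3 * u3 ->
  ideal_gen (quadrics_of_rank 3)
    (lift_form B u1 * lift_form B u2 - lift_form B u3 * lift_form B u3).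
Proof.
move=> W1 W2 W3 E; apply: ideal_gen_incl.
have hq : lift_form B u1 * lift_form B u2 - lift_form B u3 * lift_form B u3 \is 2.-homog.
  by apply: rpredB; apply: linform_mul_homog.
split=> //.
  apply: (@quadric_rankB _ _ _ _ 2 1); first exact: quadric_rank_mul.
  exact: quadric_rank_sqr.
apply/(vanishes_onP hq); rewrite /curve_ev rmorphB !rmorphM /= -/(curve_ev B).
by rewrite !curve_ev_lift // E subrr.
Qed.

Variables (e : nat) (g : {poly K}).
Hypothesis e_ge4 : (4 <= e)%N.
Hypothesis e_le : (2 * e <= N + 2)%N.
Hypothesis g_monic : g \is monic.
Hypothesis size_g : size g = e.+1.
Hypothesis apolar_g : apolar a e g.
Hypothesis g_min : forall k (h : {poly K}), h \is monic -> size h = k.+1 ->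
  apolar a k h -> (e <= k)%N.

Lemma ideal_by_quadrics4 d f : f \is d.-homog -> vanishes_on X f ->
  ideal_gen (quadrics_of_rank 4) f.
Proof.
move=> hf /(vanishes_onP hf) evf.
have [u [su cop phi_u gen]] : exists u : {poly K},
  [/\ (size u <= e)%N, coprimep g u,
      forall q : {poly K}, (size q <= e.-1)%N -> row_functional a (u * q) = 0
    & forall w : {poly K}, (size w <= N.+1)%N -> row_functional a w = 0 ->
        exists p q : {poly K}, [/\ (size p <= N.+1 - e)%N, (size q <= e.-1)%N
                      & w = g * p + u * q]].
  apply: apolar_second_generator => //; first by lia.
    by move=> p sp; apply: apolar_g; lia.
  move=> k k_monic sk; apply: NNPP => nk.
  have k_gt0 : (0 < size k)%N by rewrite size_poly_gt0 monic_neq0.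
  have := @g_min (size k).-1 k k_monic; rewrite prednK // => /(_ erefl).
  suff ak : apolar a (size k).-1 k by move/(_ ak); lia.
  move=> q sq; apply/eqP/negPn/negP => aq; apply: nk.
  have aux x y : (0 < x -> y + x.-1 <= N.+1 -> y + x <= N + 2)%N by lia.
  by exists q; split=> //; apply: aux sq.
pose W := hyperplane_form.
have Wgen b (p : {poly K}) : (size p <= (if b then N - e else e - 2).+1)%N ->
    W ((if b then g else u) * p).
  case: b => sp; split.
  - have := size_polyMleq g p; rewrite size_g.
    have aux x y : (x <= (N - e).+1 -> y <= (e.+1 + x).-1 -> y <= N.+1)%N by lia.
    exact: aux sp.
  - have aux x : (x <= (N - e).+1 -> x + e <= N.+1)%N by lia.
    by apply: apolar_g; apply: aux sp.
  - have aux x y z : (x <= (e - 2).+1 -> z <= e -> y <= (z + x).-1 -> y <= N.+1)%N by lia.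
    exact: aux sp su (size_polyMleq u p).
  - have aux x : (x <= (e - 2).+1 -> x <= e.-1)%N by lia.
    by apply: phi_u; apply: aux sp.
(* The scroll has [A = N - e] and [B = e - 2]; the bounds [4 <= e] and [2 * e <= N + 2] make both at
   least 2. *)
apply: (@scroll_ideal K N (ideal_gen (quadrics_of_rank 4)) (ideal_gen_ideal _)
    (coordinate_poly B) (lift_form B) W (N - e) (e - 2) g u _ _ _ _ cop Wgen
    _ _ _ _ d f hf evf).
- by lia.
- by lia.
- by rewrite size_g; lia.
- by have aux x : (x <= e -> x <= N - e + 3)%N by [lia]; apply: aux su.
- by move=> v Wv; apply: curve_ev_lift.
- by move=> h; apply: quadrics_of_rank_ev.
- exact: quadric4_in_ideal.
move=> k; have [sw aw] := coordinate_poly_hyperplane k.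
have [p [q [sp sq Ew]]] := gen _ sw aw.
exists p, q; split; last by rewrite -Ew; apply: esym (lift_coordinate_poly k).
  have aux x : (x <= N.+1 - e -> x <= (N - e).+1)%N by lia.
  exact: aux sp.
have aux x : (x <= e.-1 -> x <= (e - 2).+1)%N by lia.
exact: aux sq.
Qed.

End PointProjection.

(** * Quadrics of rank 3 for a coordinate point *)

Section MonomialQuadrics.

Variables (K : fieldType) (n N c : nat) (J : {mpoly K[n]} -> Prop).
Hypothesis charK0 : [pchar K] =i pred0.
Hypothesis idJ : ideal_pred J.
Variable L : {linear {poly K} -> {mpoly K[n]}}.
Let W (u : {poly K}) : Prop := (size u <= N.+1)%N /\ u`_c = 0.
Hypothesis J_conic : forall u1 u2 u3, W u1 -> W u2 -> W u3 ->
  u1 * u2 = u3 * u3 -> J (L u1 * L u2 - L u3 * L u3).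
Hypothesis c_ge3 : (3 <= c)%N.
Hypothesis c_le : (c + 3 <= N)%N.

Let ok x := (x <= N)%N && (x != c).
Let z i := L 'X^i.
Let P i j := z i * z j.

Let natr_neq0 k : (0 < k)%N -> k%:R != 0 :> K.
Proof. by have /pcharf0P-> := charK0; case: k. Qed.

Let J_half f : J (2%:R *: f) -> J f.
Proof. exact: (ideal_cancel_scale idJ (natr_neq0 (isT : (0 < 2)%N))). Qed.

Let PC i j : P i j = P j i.
Proof. exact: mulrC. Qed.

Let WX i : ok i -> W 'X^i.
Proof.
case/andP=> iN ic; split; first by rewrite size_polyXn.
by rewrite coefXn eq_sym (negPf ic).
Qed.

Let W_lin k u v : W u -> W v -> W (k *: u + v).
Proof.
move=> [su uc] [sv vc]; split; last by rewrite coefD coefZ uc vc mulr0 addr0.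
apply: leq_trans (size_polyD _ _) _; rewrite geq_max sv andbT.
exact: leq_trans (size_scale_leq _ _) su.
Qed.

Let WD u v : W u -> W v -> W (u + v).
Proof. by move=> Wu; rewrite -[u]scale1r; apply: W_lin. Qed.

(* Polarization of the conics [x^i, x^(i+k), x^(i+2k)]: along an antidiagonal,
   [P] is affine on every arithmetic progression avoiding [c]. *)
Let progression x0 y0 x1 y1 x2 y2 :
  [&& ok x0, ok y0, ok x1, ok y1, ok x2 & ok y2] ->
  (x0 + y0 = x1 + y1)%N -> (x2 + y2 = x1 + y1)%N -> (x0 + x2 = x1 + x1)%N ->
  J (P x0 y0 + P x2 y2 - 2%:R *: P x1 y1).
Proof.
wlog x01 : x0 y0 x2 y2 / (x0 <= x1)%N.
  move=> H oks E0 E2 Ex; have [?|?] := leqP x0 x1; first exact: H.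
  by rewrite [P x0 y0 + _]addrC; apply: H => //; move: oks; lia.
case/and5P=> ok0 oky0 ok1 oky1 /andP[ok2 oky2] E0 E2 Ex.
have conic u1 u2 u3 v1 v2 v3 : ok u1 -> ok u2 -> ok u3 -> ok v1 -> ok v2 -> ok v3 ->
    ('X^u1 + 'X^v1) * ('X^u2 + 'X^v2) = ('X^u3 + 'X^v3) * ('X^u3 + 'X^v3) :> {poly K} ->
    J ((z u1 + z v1) * (z u2 + z v2) - (z u3 + z v3) * (z u3 + z v3)).
  move=> *; rewrite -!raddfD; apply: J_conic => //; apply: WD; exact: WX.
have [k Ek] : exists k, (x1 = x0 + k)%N by exists (x1 - x0)%N; lia.
have Ex2 : x2 = (x0 + k + k)%N by lia.
have Ey1 : y1 = (y2 + k)%N by lia.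
have Ey0 : y0 = (y2 + k + k)%N by lia.
(* This conic consists of ['X^x0 + 'X^y2] multiplied by 1, ['X^k] and ['X^(k + k)]. Removing the
   conics [H1] and [H2] of the two summands leaves the mixed terms. *)
subst x1 x2 y1 y0; have H := conic _ _ _ _ _ _ ok0 ok2 ok1 oky2 oky0 oky1.
have H1 : J (z x0 * z (x0 + k + k)%N - z (x0 + k)%N * z (x0 + k)%N).
  by apply: J_conic; try exact: WX; rewrite !exprD; ring.
have H2 : J (z y2 * z (y2 + k + k)%N - z (y2 + k)%N * z (y2 + k)%N).
  by apply: J_conic; try exact: WX; rewrite !exprD; ring.
have {}H := H ltac:(by rewrite !exprD; ring).
rewrite (_ : _ - _ = (z x0 + z y2) * (z (x0 + k + k)%N + z (y2 + k + k)%N)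
  - (z (x0 + k)%N + z (y2 + k)%N) * (z (x0 + k)%N + z (y2 + k)%N)
  - (z x0 * z (x0 + k + k)%N - z (x0 + k)%N * z (x0 + k)%N)
  - (z y2 * z (y2 + k + k)%N - z (y2 + k)%N * z (y2 + k)%N)).
  by apply: (idealB idJ) => //; apply: (idealB idJ).
by rewrite /P -mul_mpolyC mpolyC_nat; ring.
Qed.

(** The progression [x], [m], [y] is symmetric, so both of its ends give the same product. *)
Let even_center x y m : ok x -> ok y -> ok m -> (x + y = m + m)%N ->
  J (P x y - P m m).
Proof.
move=> okx oky okm E; apply: J_half.
have -> : 2%:R *: (P x y - P m m) = P x y + P y x - 2%:R *: P m m.
  by rewrite [P y x]PC -!mul_mpolyC mpolyC_nat; ring.
by apply: progression => //; [rewrite okx oky okm | lia].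
Qed.

Let progression_end a b m f0 : J (a + b - 2%:R *: m) -> J (b - f0) -> J (m - f0) ->
  J (a - f0).
Proof.
move=> H Hb Hm.
rewrite (_ : a - f0 = (a + b - 2%:R *: m) - (b - f0) + 2%:R *: (m - f0)).
  by apply: (idealD idJ); [apply: (idealB idJ) | apply: (idealZ idJ)].
by rewrite -!mul_mpolyC mpolyC_nat; ring.
Qed.

(** The centre [(c, c)] is missing. The progression [c - 1], [c + 1], [c + 3] jumps over it and
    settles distance 3; distance 2 is the midpoint of 1 and 3, and larger distances follow by unit
    steps. *)
Let double_center k : (0 < k)%N -> ok (c + k) -> ok (c - k) -> (k <= c)%N ->
  J (P (c + k) (c - k) - P c.+1 c.-1).
Proof.
have J3 : J (P (c + 3) (c - 3) - P c.+1 c.-1).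
  have H : J (P (c + 3) (c - 3) + P c.-1 c.+1 - 2%:R *: P c.+1 c.-1).
    by apply: progression; rewrite /ok; lia.
  by apply: (progression_end H); rewrite ?[P c.-1 _]PC subrr; apply: ideal0.
have J2 : J (P (c + 2) (c - 2) - P c.+1 c.-1).
  apply: J_half.
  have H : J (P c.+1 c.-1 + P (c + 3) (c - 3) - 2%:R *: P (c + 2) (c - 2)).
    by apply: progression; rewrite /ok; lia.
  rewrite (_ : 2%:R *: _ = (P (c + 3) (c - 3) - P c.+1 c.-1)
     - (P c.+1 c.-1 + P (c + 3) (c - 3) - 2%:R *: P (c + 2) (c - 2))).
    exact: (idealB idJ).
  by rewrite -!mul_mpolyC mpolyC_nat; ring.
elim/ltn_ind: k => k IH k0 ok1 ok2 kc.
have [k_le3|k4] := leqP k 3.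
  case: k k_le3 IH k0 ok1 ok2 kc => [|[|[|[|]]]] //= *.
  by rewrite addn1 subn1 subrr; apply: ideal0.
have H : J (P (c + k) (c - k) + P (c + (k - 2)) (c - (k - 2)) - 2%:R *: P (c + (k - 1)) (c - (k - 1))).
  by apply: progression; move: ok1 ok2; rewrite /ok; lia.
by apply: (progression_end H); apply: IH; move: ok1 ok2; rewrite /ok; lia.
Qed.

(** * The antidiagonals [2c - 1] and [2c + 1] *)

Section ShiftedConic.

Let Y i := z (c - 3 + i).

Let Y_ok i : (i <= 6)%N -> i != 3%N -> ok (c - 3 + i).
Proof. by rewrite /ok; lia. Qed.

Let J_even i j m : (i <= 6)%N -> (j <= 6)%N -> (m <= 6)%N ->
  i != 3%N -> j != 3%N -> m != 3%N -> (i + j = m + m)%N -> J (Y i * Y j - Y m * Y m).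
Proof. by move=> *; apply: even_center; rewrite ?Y_ok //; lia. Qed.

Lemma shifted_six0 : J (Y 0 * Y 6 - Y 1 * Y 5).
Proof.
have H3 := @double_center 3 isT; have H2 := @double_center 2 isT.
rewrite -[Y 0 * _]/(P _ _) -[Y 1 * _]/(P _ _).
rewrite [X in X - _]PC [X in _ - X]PC.
have -> : (c - 3 + 6 = c + 3)%N by lia.
have -> : (c - 3 + 0 = c - 3)%N by lia.
have -> : (c - 3 + 5 = c + 2)%N by lia.
have -> : (c - 3 + 1 = c - 2)%N by lia.
apply: (ideal_cong_trans idJ (H3 _ _ _)); try by rewrite /ok; lia.
by apply: (ideal_cong_sym idJ); apply: H2; rewrite /ok; lia.
Qed.

Lemma shifted_six2 : J (Y 2 * Y 4 - Y 1 * Y 5).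
Proof.
have H2 := @double_center 2 isT.
rewrite -[Y 2 * _]/(P _ _) -[Y 1 * _]/(P _ _).
rewrite [X in X - _]PC [X in _ - X]PC.
have -> : (c - 3 + 4 = c.+1)%N by lia.
have -> : (c - 3 + 2 = c.-1)%N by lia.
have -> : (c - 3 + 5 = c + 2)%N by lia.
have -> : (c - 3 + 1 = c - 2)%N by lia.
by apply: (ideal_cong_sym idJ); apply: H2; rewrite /ok; lia.
Qed.

(* The conic [f, v f, v^2 f] with [f = 1 - 2 b x + 2 b^2 x^2], [v = x + b x^2],
   multiplied by [x^(c-3)]. *)
Let J_shifted (b : K) :
  J ((b ^+ 3 * 2%:R) *: (Y 0 * Y 5 - Y 1 * Y 4) + (b ^+ 5 * 4%:R) *: (Y 2 * Y 5 - Y 1 * Y 6)).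
Proof.
pose X i : {poly K} := 'X^(c - 3 + i).
have XE i : X i = 'X^(c - 3) * 'X^i by rewrite /X exprD.
have WY i : (i <= 6)%N -> i != 3%N -> W (X i) by move=> *; apply/WX/Y_ok.
have H := J_conic (u1 := (- (2%:R * b)) *: X 1%N + (2%:R * b ^+ 2) *: X 2%N + X 0%N)
  (u2 := (- b ^+ 2) *: X 4%N + (2%:R * b ^+ 3) *: X 5%N + (2%:R * b ^+ 4) *: X 6%N + X 2%N)
  (u3 := (- b) *: X 2%N + (2%:R * b ^+ 3) *: X 4%N + X 1%N).
have {}H := H ltac:(by rewrite -addrA; do !apply: W_lin => //; apply: WY)
  ltac:(by rewrite -!addrA; do !apply: W_lin => //; apply: WY)
  ltac:(by rewrite -!addrA; do !apply: W_lin => //; apply: WY) _.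
have {}H := H ltac:(by rewrite !XE -!mul_polyC; ring).
move: H; rewrite !linearD !linearZ /= -!/(Y _) => H.
have e2 := J_even (isT : 0 <= 6)%N (isT : 2 <= 6)%N (isT : 1 <= 6)%N isT isT isT erefl.
have e4 := J_even (isT : 0 <= 6)%N (isT : 4 <= 6)%N (isT : 2 <= 6)%N isT isT isT erefl.
have e8 := J_even (isT : 2 <= 6)%N (isT : 6 <= 6)%N (isT : 4 <= 6)%N isT isT isT erefl.
have s0 := shifted_six0; have s2 := shifted_six2.
(* The terms of even index sum in [Y] are corrected by known relations and those of sum 3 cancel;
   the sums 5 and 7 remain. *)
rewrite (_ : _ + _ =
  ((- (2%:R * b)) *: Y 1%N + (2%:R * b ^+ 2) *: Y 2%N + Y 0%N)
  * ((- b ^+ 2) *: Y 4%N + (2%:R * b ^+ 3) *: Y 5%N + (2%:R * b ^+ 4) *: Y 6%N + Y 2%N)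
  - ((- b) *: Y 2%N + (2%:R * b ^+ 3) *: Y 4%N + Y 1%N)
  * ((- b) *: Y 2%N + (2%:R * b ^+ 3) *: Y 4%N + Y 1%N)
  - (Y 0 * Y 2 - Y 1 * Y 1) + b ^+ 2 *: (Y 0 * Y 4 - Y 2 * Y 2)
  - (2%:R * b ^+ 4) *: (Y 0 * Y 6 - Y 1 * Y 5 + (Y 2 * Y 4 - Y 1 * Y 5))
  - (4%:R * b ^+ 6) *: (Y 2 * Y 6 - Y 4 * Y 4)).
  apply: (idealB idJ); last exact: (idealZ idJ).
  apply: (idealB idJ); last by apply: (idealZ idJ); apply: (idealD idJ).
  by apply: (idealD idJ); [apply: (idealB idJ) | apply: (idealZ idJ)].
by rewrite -!mul_mpolyC; ring.
Qed.

Lemma shifted_conic_above : J (Y 2 * Y 5 - Y 1 * Y 6).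
Proof.
(* The two differences in [J_shifted] carry [b ^+ 3] and [b ^+ 5], so two values of [b] separate
   them. Subtracting 8 times the case [b = 1] from the case [b = 2] leaves the coefficient 128 - 32
   = 96. *)
apply: (ideal_cancel_scale idJ (natr_neq0 (isT : 0 < 96)%N)).
rewrite (_ : _ *: _ = ((2%:R ^+ 3 * 2%:R) *: (Y 0 * Y 5 - Y 1 * Y 4)
    + (2%:R ^+ 5 * 4%:R) *: (Y 2 * Y 5 - Y 1 * Y 6))
  - 8%:R *: ((1 ^+ 3 * 2%:R) *: (Y 0 * Y 5 - Y 1 * Y 4)
    + (1 ^+ 5 * 4%:R) *: (Y 2 * Y 5 - Y 1 * Y 6))).
  by apply: (idealB idJ); [apply: J_shifted | apply/(idealZ idJ)/J_shifted].
by rewrite -!mul_mpolyC; ring.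
Qed.

Lemma shifted_conic_below : J (Y 0 * Y 5 - Y 1 * Y 4).
Proof.
apply: J_half.
rewrite (_ : _ *: _ = ((1 ^+ 3 * 2%:R) *: (Y 0 * Y 5 - Y 1 * Y 4)
    + (1 ^+ 5 * 4%:R) *: (Y 2 * Y 5 - Y 1 * Y 6))
    - 4%:R *: (Y 2 * Y 5 - Y 1 * Y 6)).
  by apply: (idealB idJ); [apply: J_shifted | apply/(idealZ idJ)/shifted_conic_above].
by rewrite -!mul_mpolyC; ring.
Qed.

End ShiftedConic.

(** * The antidiagonals [2c - 3] and [2c + 3], through a window that can be read in either
    direction *)

Section FarConic.

Variable sigma : nat -> nat.
Hypothesis sigma_ok : forall i, (i <= 7)%N -> i != 3%N -> ok (sigma i).
Hypothesis sigma_affine : forall i j k l, (i <= 7)%N -> (j <= 7)%N -> (k <= 7)%N ->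
  (l <= 7)%N -> (i + j = k + l)%N -> (sigma i + sigma j = sigma k + sigma l)%N.
Let Y i := z (sigma i).
Let X i : {poly K} := 'X^(sigma i).
Hypothesis six0 : J (Y 0 * Y 6 - Y 1 * Y 5).
Hypothesis six2 : J (Y 2 * Y 4 - Y 1 * Y 5).
Hypothesis five : J (Y 0 * Y 5 - Y 1 * Y 4).
Hypothesis seven : J (Y 2 * Y 5 - Y 1 * Y 6).

(* The conic [f u^2, f u v, f v^2] with [f = x^3 - x - 1], [u = x + 1] and
   [v = x^2 + 2]: none of the three has a term in [x^3]. *)
Lemma far_conic :
  (X 5 + 2%:R *: X 4 - 3%:R *: X 2 - 3%:R *: X 1 - X 0) *
  (X 7 + 3%:R *: X 5 - X 4 - 4%:R *: X 2 - 4%:R *: X 1 - 4%:R *: X 0) =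
  (X 6 + X 5 + X 4 - 3%:R *: X 2 - 4%:R *: X 1 - 2%:R *: X 0) *
  (X 6 + X 5 + X 4 - 3%:R *: X 2 - 4%:R *: X 1 - 2%:R *: X 0) ->
  J (Y 4 * Y 5 - Y 2 * Y 7).
Proof.
have WX' i : (i <= 7)%N -> i != 3%N -> W (X i) by move=> *; apply/WX/sigma_ok.
have WB u v : W u -> W v -> W (u - v).
  by move=> Wu Wv; rewrite addrC -scaleN1r; apply: W_lin.
have WZ k u : W u -> W (k *: u).
  by move=> Wu; rewrite -[_ *: _]addr0; apply: W_lin => //; split; rewrite ?size_poly0 ?coef0.
have JY i j m : (i <= 7)%N -> (j <= 7)%N -> (m <= 7)%N ->
    i != 3%N -> j != 3%N -> m != 3%N -> (i + j = m + m)%N -> J (Y i * Y j - Y m * Y m).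
  by move=> *; apply: even_center; rewrite ?sigma_ok //; apply: sigma_affine.
have e2 := @JY 0 2 1 isT isT isT isT isT isT erefl.
have e4 := @JY 0 4 2 isT isT isT isT isT isT erefl.
have e8 := @JY 2 6 4 isT isT isT isT isT isT erefl.
have e8' := @JY 1 7 4 isT isT isT isT isT isT erefl.
have e10 := @JY 4 6 5 isT isT isT isT isT isT erefl.
have e12 := @JY 5 7 6 isT isT isT isT isT isT erefl.
have e7 : J (Y 0 * Y 7 + Y 2 * Y 5 - 2%:R *: (Y 1 * Y 6)).
  by apply: progression; rewrite ?sigma_ok //; apply: sigma_affine.
have e11 : J (Y 4 * Y 7 + Y 6 * Y 5 - 2%:R *: (Y 5 * Y 6)).
  by apply: progression; rewrite ?sigma_ok //; apply: sigma_affine.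
have WXs : forall i, [|| i == 0, i == 1, i == 2, i == 4, i == 5, i == 6 | i == 7]%N -> W (X i).
  by move=> i ?; apply: WX'; lia.
have W1 : W (X 5 + 2%:R *: X 4 - 3%:R *: X 2 - 3%:R *: X 1 - X 0).
  by repeat lazymatch goal with
    | |- W (_ - _) => apply WB | |- W (_ + _) => apply WD
    | |- W (_ *: _) => apply WZ | |- W (X _) => exact: WXs end.
have W2 : W (X 7 + 3%:R *: X 5 - X 4 - 4%:R *: X 2 - 4%:R *: X 1 - 4%:R *: X 0).
  by repeat lazymatch goal with
    | |- W (_ - _) => apply WB | |- W (_ + _) => apply WD
    | |- W (_ *: _) => apply WZ | |- W (X _) => exact: WXs end.
have W3 : W (X 6 + X 5 + X 4 - 3%:R *: X 2 - 4%:R *: X 1 - 2%:R *: X 0).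
  by repeat lazymatch goal with
    | |- W (_ - _) => apply WB | |- W (_ + _) => apply WD
    | |- W (_ *: _) => apply WZ | |- W (X _) => exact: WXs end.
move=> /(J_conic W1 W2 W3).
rewrite !linearB !linearD !linearZ /= -!/(Y _) => H.
(* All other index sums cancel or are known, and the sum 9 is left as 5 - 2 = 3 times [Y 4 * Y 5]
   minus 3 times [Y 2 * Y 7]. *)
apply: (ideal_cancel_scale idJ (natr_neq0 (isT : 0 < 3)%N)).
set Q := (X in J X) in H.
rewrite (_ : _ *: _ = Q - (Y 5 * Y 7 - Y 6 * Y 6)
  - 2%:R *: (Y 4 * Y 7 + Y 6 * Y 5 - 2%:R *: (Y 5 * Y 6))
  + 2%:R *: (Y 4 * Y 6 - Y 5 * Y 5)
  - 6%:R *: (Y 2 * Y 6 - Y 4 * Y 4) + 3%:R *: (Y 1 * Y 7 - Y 4 * Y 4)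
  + 6%:R *: (Y 2 * Y 5 - Y 1 * Y 6)
  + (Y 0 * Y 7 + Y 2 * Y 5 - 2%:R *: (Y 1 * Y 6))
  - (Y 2 * Y 4 - Y 1 * Y 5) - 4%:R *: (Y 0 * Y 6 - Y 1 * Y 5)
  + 3%:R *: (Y 0 * Y 5 - Y 1 * Y 4) + 3%:R *: (Y 0 * Y 4 - Y 2 * Y 2)
  - 4%:R *: (Y 0 * Y 2 - Y 1 * Y 1)).
  exact: (idealB idJ (idealD idJ (idealD idJ (idealB idJ (idealB idJ (idealD idJ
    (idealD idJ (idealD idJ (idealB idJ (idealD idJ (idealB idJ (idealB idJ H
    e12) (idealZ idJ _ e11)) (idealZ idJ _ e10)) (idealZ idJ _ e8)) (idealZ
    idJ _ e8')) (idealZ idJ _ seven)) e7) six2) (idealZ idJ _ six0)) (idealZ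
    idJ _ five)) (idealZ idJ _ e4)) (idealZ idJ _ e2)).
by rewrite /Q -!mul_mpolyC; ring.
Qed.

End FarConic.

Let far_above : (c + 4 <= N)%N -> J (P (c + 2) c.+1 - P (c + 4) c.-1).
Proof.
move=> c4; have H := @far_conic (fun i => c - 3 + i)%N.
rewrite [P (c + 2) _]PC [P (c + 4) _]PC.
have -> : c.+1 = (c - 3 + 4)%N by lia.
have -> : (c + 2 = c - 3 + 5)%N by lia.
have -> : c.-1 = (c - 3 + 2)%N by lia.
have -> : (c + 4 = c - 3 + 7)%N by lia.
apply: H.
- by move=> i; rewrite /ok; lia.
- by move=> *; lia.
- exact: shifted_six0.
- exact: shifted_six2.
- exact: shifted_conic_below.
- exact: shifted_conic_above.
by rewrite !exprD -!mul_polyC; ring.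
Qed.

Let far_below : (4 <= c)%N -> J (P c.-1 (c - 2) - P c.+1 (c - 4)).
Proof.
move=> c4; have H := @far_conic (fun i => c + 3 - i)%N.
have -> : c.-1 = (c + 3 - 4)%N by lia.
have -> : (c - 2 = c + 3 - 5)%N by lia.
have -> : c.+1 = (c + 3 - 2)%N by lia.
have -> : (c - 4 = c + 3 - 7)%N by lia.
apply: H.
- by move=> i; rewrite /ok; lia.
- by move=> *; lia.
- have := shifted_six0; rewrite [X in X - _]mulrC [X in _ - X]mulrC.
  by congr (J (_ * _ - _ * _)); congr (z _); lia.
- have := shifted_six2; rewrite [X in X - _]mulrC [X in _ - X]mulrC.
  by congr (J (_ * _ - _ * _)); congr (z _); lia.
(* Reversing the window exchanges the index sums 5 and 7, so the two shifted conics swap roles. *)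
- have := ideal_cong_sym idJ shifted_conic_above.
  rewrite [X in X - _]mulrC [X in _ - X]mulrC.
  by congr (J (_ * _ - _ * _)); congr (z _); lia.
- have := ideal_cong_sym idJ shifted_conic_below.
  rewrite [X in X - _]mulrC [X in _ - X]mulrC.
  by congr (J (_ * _ - _ * _)); congr (z _); lia.
have XE i : (i <= 7)%N -> 'X^(c + 3 - i) = 'X^(c - 4) * 'X^(7 - i) :> {poly K}.
  by move=> i7; rewrite -exprD; congr (_ ^+ _); lia.
by rewrite !XE // -!mul_polyC; ring.
Qed.

(** * Exchange of products along an odd antidiagonal *)

Section OddAntidiagonal.

Variable m : nat.
Let G k := P (m.+1 + k) (m - k).
Let dom k := [&& (k <= m)%N, ok (m.+1 + k) & ok (m - k)].

Let dom0 k : dom k -> c != m -> c != m.+1 -> dom 0.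
Proof. by rewrite /dom /ok; lia. Qed.

Let first_step k : dom 0 -> dom k -> dom k.+1 -> J (G k.+1 + G k - 2%:R *: G 0).
Proof.
case/and3P=> m0 ok0 ok0' /and3P[mk ok1 ok1'] /and3P[mk' ok2 ok2'].
rewrite [G k]PC; apply: progression; first by rewrite ok0 ok0' ok1 ok1' ok2 ok2'.
all: by clear -mk'; lia.
Qed.

Let second_step k : dom 1 -> dom k -> dom k.+3 -> J (G k.+3 + G k - 2%:R *: G 1).
Proof.
case/and3P=> m0 ok0 ok0' /and3P[mk ok1 ok1'] /and3P[mk' ok2 ok2'].
rewrite [G k]PC; apply: progression; first by rewrite ok0 ok0' ok1 ok1' ok2 ok2'.
all: by clear -mk'; lia.
Qed.

Let third_step k : dom k -> dom k.+1 -> dom k.+2 ->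
  J (G k.+2 + G k - 2%:R *: G k.+1).
Proof.
case/and3P=> m0 ok0 ok0' /and3P[mk ok1 ok1'] /and3P[mk' ok2 ok2'].
apply: progression; first by rewrite ok0 ok0' ok1 ok1' ok2 ok2'.
all: by clear -mk'; lia.
Qed.

(** Both [G 0] and [G 1] can serve as centres. Reflection in [G 0] reaches each index from the
    preceding one; if that one is lost to [c], reflection in [G 1] reaches it from three places
    back. *)
Let odd_generic k : c != m -> c != m.+1 -> c != m.-1 -> c != m.+2 -> dom k ->
  J (G k - G 0).
Proof.
move=> c0 c1 c2 c3; elim/ltn_ind: k => -[|k] IH d.
  by rewrite subrr; apply: ideal0.
have d0 := dom0 d c0 c1.
have J0 : J (G 0 - G 0) by rewrite subrr; apply: ideal0.
have [dk|ndk] := boolP (dom k).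
  by apply: (progression_end (first_step d0 dk d)) => //; apply: IH.
case: k => [|[|k]] in IH d ndk *.
- by rewrite d0 in ndk.
- by case/negP: ndk; move: d d0; rewrite /dom /ok; lia.
have d1 : dom 1 by move: d d0; rewrite /dom /ok; lia.
have dk : dom k by move: d ndk; rewrite /dom /ok; lia.
apply: (progression_end (second_step d1 dk d)); apply: IH => //.
by rewrite ltnS leqW.
Qed.

(** [G 0] is lost, and a progression across the gap needs a step of at least 3, for which there may
    be no room when [c] is near an end. The shifted conics compare [G 2] with [G 1] instead, which
    fixes the slope. *)
Let odd_adjacent k : (c == m) || (c == m.+1) -> dom k -> J (G k - G 1).
Proof.
move=> cm; elim/ltn_ind: k => -[|[|[|k]]] IH d.
- by exfalso; move: d; rewrite /dom /ok; lia.
- by rewrite subrr; apply: ideal0.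
- case/orP: cm => /eqP Ec.
    have := ideal_cong_sym idJ shifted_conic_above; rewrite [X in X - _]mulrC [X in _ - X]mulrC.
    by congr (J (_ * _ - _ * _)); congr z; move: d; rewrite /dom /ok; lia.
  have := shifted_conic_below; rewrite [X in X - _]mulrC [X in _ - X]mulrC.
  by congr (J (_ * _ - _ * _)); congr z; move: d; rewrite /dom /ok; lia.
have dk2 : dom k.+2 by move: d; rewrite /dom /ok; lia.
have dk1 : dom k.+1 by move: d; rewrite /dom /ok; lia.
by apply: (progression_end (third_step dk1 dk2 d)); apply: IH.
Qed.

(** [G 1] is lost, so no reflection in [G 0] reaches [G 2]; the far conics make this step. *)
Let odd_next k : (c == m.-1) || (c == m.+2) -> dom k -> J (G k - G 0).
Proof.
move=> cm; elim/ltn_ind: k => -[|[|[|k]]] IH d.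
- by rewrite subrr; apply: ideal0.
- by exfalso; move: d; rewrite /dom /ok; lia.
- case/orP: cm => /eqP Ec.
    have := ideal_cong_sym idJ (far_above _).
    move=> /(_ ltac:(move: d; rewrite /dom /ok; lia)).
    by congr (J (_ * _ - _ * _)); congr z; move: d; rewrite /dom /ok; lia.
  have := ideal_cong_sym idJ (far_below _).
  move=> /(_ ltac:(move: d; rewrite /dom /ok; lia)).
  by congr (J (_ * _ - _ * _)); congr z; move: d; rewrite /dom /ok; lia.
have dk2 : dom k.+2 by move: d; rewrite /dom /ok; lia.
have d0 : dom 0 by move: d; rewrite /dom /ok; lia.
apply: (progression_end (first_step d0 dk2 d)) => //; first exact: IH.
by rewrite subrr; apply: ideal0.
Qed.

Lemma odd_exchange k k' : dom k -> dom k' -> J (G k - G k').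
Proof.
have [cm|cm] := boolP ((c == m) || (c == m.+1)).
  move=> /(odd_adjacent cm) H /(odd_adjacent cm)/(ideal_cong_sym idJ).
  exact: ideal_cong_trans.
have [cm'|cm'] := boolP ((c == m.-1) || (c == m.+2)).
  move=> /(odd_next cm') H /(odd_next cm')/(ideal_cong_sym idJ).
  exact: ideal_cong_trans.
move: cm cm'; rewrite !negb_or => /andP[c0 c1] /andP[c2 c3].
move=> /(odd_generic c0 c1 c2 c3) H /(odd_generic c0 c1 c2 c3)/(ideal_cong_sym idJ).
exact: ideal_cong_trans.
Qed.

End OddAntidiagonal.

Lemma monomial_exchange i j k l :
  [&& ok i, ok j, ok k & ok l] -> (i + j = k + l)%N ->
  J (z i * z j - z k * z l).
Proof.
move=> oks E; rewrite -/(P i j) -/(P k l).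
wlog ji : i j oks E / (j <= i)%N.
  move=> H; have [?|/ltnW ij] := leqP j i; first exact: H.
  by rewrite PC; apply: H => //; [move: oks | move: E]; lia.
wlog lk : k l oks E / (l <= k)%N.
  move=> H; have [?|/ltnW kl] := leqP l k; first exact: H.
  by rewrite [P k l]PC; apply: H => //; [move: oks | move: E]; lia.
case/and4P: oks => oki okj okk okl.
have [m Em] : exists m, (i + j = m + m \/ i + j = (m + m).+1)%N.
  by exists (i + j)./2; lia.
case: Em => Em.
  have [cm|cm] := eqVneq m c; last first.
    have okm : ok m by move: oki okj; rewrite /ok; lia.
    apply: (ideal_cong_trans idJ (even_center oki okj okm Em)).
    by apply: (ideal_cong_sym idJ); apply: even_center => //; rewrite -E.
  have center x y : ok x -> ok y -> (y <= x)%N -> (x + y = c + c)%N -> J (P x y - P c.+1 c.-1).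
    move=> okx oky yx Exy; have Ex : x = (c + (x - c))%N by move: okx oky; lia.
    have Ey : y = (c - (x - c))%N by lia.
    rewrite Ey {1}Ex; apply: double_center; rewrite -?Ex -?Ey //; last by lia.
    by move: okx oky; rewrite /ok; lia.
  apply: (ideal_cong_trans idJ (g := P c.+1 c.-1)).
    by apply: center; rewrite // -cm.
  by apply: (ideal_cong_sym idJ); apply: center; rewrite // -E Em cm.
have oddE x y : (y <= x)%N -> (x + y = (m + m).+1)%N ->
    (x = m.+1 + (x - m.+1) /\ y = m - (x - m.+1))%N by lia.
have [Ei Ej] := oddE i j ji Em.
have [Ek El] := oddE k l lk (etrans (esym E) Em).
rewrite Ei Ej Ek El; apply: odd_exchange; rewrite -?Ei -?Ej -?Ek -?El ?oki ?okj ?okk ?okl; lia.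
Qed.

End MonomialQuadrics.

(** * The rank index *)

Section RankTwo.

Variables (K : closedFieldType) (charK0 : [pchar K] =i pred0).

Let two_neq0 : 2%:R != 0 :> K.
Proof. by have /pcharf0P-> := charK0. Qed.

Lemma square_root_exists (x : K) : exists y : K, y ^+ 2 = x.
Proof.
have /closed_rootP[y] : size ('X^2 - x%:P) != 1%N by rewrite size_XnsubC.
by rewrite /root !hornerE subr_eq0 => /eqP; exists y.
Qed.

(** Up to the factor [al], the quadratic form splits into linear combinations of [f] and [h], one of
    which has to vanish. *)
Lemma binary_quadric_eq0 (al be ga : K) (f h : {poly K}) :
  (forall c c', c *: f + c' *: h = 0 -> c = 0 /\ c' = 0) ->
  al *: (f * f) + (2%:R * be) *: (f * h) + ga *: (h * h) = 0 ->
  [/\ al = 0, be = 0 & ga = 0].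
Proof.
move=> free E; have al0 : al = 0.
  apply/eqP; apply: contraT => al_neq0.
  have [de Ede] := square_root_exists (be ^+ 2 - al * ga).
  have : (al *: f + (be + de) *: h) * (al *: f + (be - de) *: h) = 0.
    rewrite (_ : _ * _ = al *: (al *: (f * f) + (2%:R * be) *: (f * h) + ga *: (h * h))
      - (de ^+ 2 - (be ^+ 2 - al * ga)) *: (h * h)).
      by rewrite E Ede subrr scaler0 scale0r subr0.
    by rewrite -!mul_polyC; ring.
  by move/eqP; rewrite mulf_eq0 => /orP[]/eqP/free[al0]; rewrite al0 eqxx in al_neq0.
move: E; rewrite al0 scale0r add0r => E.
have h0 : h != 0.
  apply/eqP => h0; have [] := free 0 1; first by rewrite h0 scale0r scaler0 addr0.
  by move=> _ /eqP; rewrite oner_eq0.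
have : h * ((2%:R * be) *: f + ga *: h) = 0.
  by rewrite -E -!mul_polyC; ring.
move/eqP; rewrite mulf_eq0 (negPf h0) => /eqP/free[/eqP].
by rewrite mulf_eq0 (negPf two_neq0) => /eqP.
Qed.

Lemma quadric_form_rank_le2_eq0 k (S : 'M[K]_k) (f : 'I_k -> {poly K}) :
  (k <= 2)%N -> S^T = S ->
  (forall c : 'rV_k, \sum_i c 0 i *: f i = 0 -> c = 0) ->
  \sum_i \sum_j S i j *: (f i * f j) = 0 -> S = 0.
Proof.
case: k S f => [|[|[|]]] //= S f _ symS free.
- by move=> _; apply: flatmx0.
- rewrite !big_ord1 => E; apply/matrixP => i j; rewrite !ord1 [RHS]mxE.
  apply/eqP; apply: contraT => S0.
  have f0 : f ord0 = 0.
    by move/eqP: E; rewrite scaler_eq0 (negPf S0) mulf_eq0 orbb => /eqP.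
  have := free (const_mx 1); rewrite big_ord1 f0 scaler0 => /(_ erefl)/rowP/(_ 0).
  by rewrite !mxE => /eqP; rewrite oner_eq0.
rewrite !big_ord_recl !big_ord0 !addr0 => E.
have symE : S (lift ord0 ord0) ord0 = S ord0 (lift ord0 ord0) by rewrite -[in LHS]symS mxE.
have [] := @binary_quadric_eq0 (S ord0 ord0) (S ord0 (lift ord0 ord0))
  (S (lift ord0 ord0) (lift ord0 ord0)) (f ord0) (f (lift ord0 ord0)).
- move=> c c' E2.
  have := free (\row_i (if i == ord0 then c else c')).
  rewrite !big_ord_recl big_ord0 addr0 !mxE eqxx /= => /(_ E2)/rowP cE.
  by have := cE ord0; have := cE (lift ord0 ord0); rewrite !mxE /=.
- by rewrite -[RHS]E symE -!mul_polyC; ring.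
move=> E0 E1 E2; apply/matrixP => i j; rewrite [RHS]mxE.
have ordE (i0 : 'I_2) : i0 = ord0 \/ i0 = lift ord0 ord0.
  by case: i0 => -[|[|]] // ?; [left | right]; apply: val_inj.
by case: (ordE i) => ->; case: (ordE j) => ->; rewrite ?symE.
Qed.

End RankTwo.

(** * Bounds for the rank index *)

Section RankIndexBounds.

Variables (K : closedFieldType) (N : nat).
Hypothesis charK0 : [pchar K] =i pred0.
Hypothesis N_gt0 : (0 < N)%N.
Notation RNC := (@rational_normal_curve K N).
Variables (B : 'M[K]_(N.+1, N)) (a : 'rV[K]_N.+1).
Hypothesis a_neq0 : a != 0.
Hypothesis kerB : (kermx B == a)%MS.
Let X := projection_image B RNC.

Let two_neq0 : 2%:R != 0 :> K.
Proof. by have /pcharf0P-> := charK0. Qed.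

Lemma property_QR_of_quadrics k :
  (forall d f, f \is d.-homog -> vanishes_on X f ->
     ideal_gen (quadrics_of_rank B k) f) -> property_QR X k.
Proof.
move=> genX; exists (quadrics_of_rank B k); split; first by move=> q [].
move=> f; split.
  apply: ideal_gen_least; first exact: ideal_gen_ideal.
  by move=> g [[d hg] gX]; apply: genX hg gX.
apply: ideal_gen_least; first exact: ideal_gen_ideal.
by move=> q [hq _ qX]; apply: ideal_gen_incl; split=> //; exists 2%N.
Qed.

Lemma homog_ideal_ev f : homog_ideal X f -> curve_ev B f = 0.
Proof.
apply: (ideal_gen_least (J := fun f => curve_ev B f = 0) (curve_ev_ideal B)).
by move=> g [[d hg] gX]; apply/(vanishes_onP a_neq0 kerB N_gt0 hg).
Qed.

Lemma curve_ev_linform_inj c : curve_ev B (linform c) = 0 -> c = 0.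
Proof.
rewrite curve_ev_linform => E.
have freeB : row_free B^T.
  rewrite /row_free mxrank_tr; have := mxrank_ker B; have := eqmx_rank kerB.
  rewrite rank_rV a_neq0 => -> /=; have := rank_leq_row B; lia.
apply: (row_free_inj freeB).
by apply: (can_inj (@rVpolyK _ _)); rewrite E mul0mx linear0.
Qed.

Lemma eval_lift u (v : 'rV[K]_N.+1) : hyperplane_form a u ->
  eval_at (lift_form B u) (v *m B) = row_functional v u.
Proof.
move=> Wu; pose c := poly_rV u *m pinvmx B^T.
have cB : c *m B^T = poly_rV u.
  rewrite -[LHS]rVpolyK -curve_ev_linform; congr poly_rV.
  exact: curve_ev_lift a_neq0 kerB _ Wu.
transitivity ((c *m B^T *m v^T) 0 0).
  rewrite -mulmxA -trmx_mul mxE /eval_at /lift_form /linform raddf_sum.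
  by apply: eq_bigr => i _; rewrite /= mevalZ mevalXU [(_^T) _ _]mxE.
by rewrite cB mxE; apply: eq_bigr => i _; rewrite !mxE mulrC.
Qed.

(** A basis [R] of the row space of the matrix presents [q] as a quadratic form in at most two
    independent linear forms. They remain independent on the curve, which lies in no hyperplane. *)
Lemma quadric_rank2_eq0 q : q \is 2.-homog -> (quadric_rank q <= 2)%N ->
  curve_ev B q = 0 -> q = 0.
Proof.
move=> hq rq evq; pose M := quadric_mx q.
have symM : M^T = M.
  by apply/matrixP => i j; rewrite !mxE eq_sym addmC; case: eqP => // ->.
have [k [R [P [k_le2 freeR MR]]]] : exists k (R : 'M[K]_(k, N)) P,
    [/\ (k <= 2)%N, row_free R & M *m P *m R = M].
  exists (\rank M), (row_base M), (pinvmx (row_base M)); split=> //.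
    exact: row_base_free.
  by rewrite mulmxKpV // eq_row_base.
pose S := P^T *m M *m P.
have RM : R^T *m P^T *m M = M.
  by have := congr1 trmx MR; rewrite !trmx_mul mulmxA symM.
have ME : M = R^T *m S *m R by rewrite /S !mulmxA RM MR.
pose l i := linform (row i R).
have qE : q = \sum_i \sum_j S i j *: (l i * l j).
  rewrite {1}(quadric_mxP two_neq0 hq) -/M.
  under [RHS]eq_bigr => i _ do under eq_bigr => j _ do rewrite mulr_suml scaler_sumr.
  under [RHS]eq_bigr => i _ do rewrite exchange_big.
  rewrite [RHS]exchange_big; apply: eq_bigr => i' _ /=.
  under [RHS]eq_bigr => i _ do under eq_bigr => j _ do rewrite mulr_sumr scaler_sumr.
  under [RHS]eq_bigr => i _ do rewrite exchange_big.
  rewrite [RHS]exchange_big; apply: eq_bigr => j' _ /=.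
  rewrite [in LHS]ME mxE scaler_suml [RHS]exchange_big; apply: eq_bigr => j _ /=.
  rewrite [in LHS]mxE mulr_suml scaler_suml; apply: eq_bigr => i _ /=.
  by rewrite !mxE -!mul_mpolyC; ring.
have S0 : S = 0.
  apply: (quadric_form_rank_le2_eq0 charK0 (f := fun i => curve_ev B (l i))) => //.
  - by rewrite /S !trmx_mul trmxK symM mulmxA.
  - move=> c E; have : curve_ev B (linform (c *m R)) = 0.
      rewrite mulmx_sum_row /linform -[RHS]E /curve_ev.
      rewrite (_ : \sum_(i < N) _ = \sum_i c 0 i *: l i).
        by rewrite raddf_sum; apply: eq_bigr => i _; rewrite /= mmapZ mul_polyC.
      under [RHS]eq_bigr => i _ do rewrite scaler_sumr.
      rewrite exchange_big; apply: eq_bigr => j _ /=.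
      by rewrite summxE scaler_suml; apply: eq_bigr => i _; rewrite !mxE scalerA.
    move/curve_ev_linform_inj => cR0; apply: (row_free_inj freeR).
    by rewrite mul0mx.
  - rewrite -[RHS]evq [in RHS]qE /curve_ev raddf_sum; apply: eq_bigr => i _ /=.
    rewrite [RHS]raddf_sum; apply: eq_bigr => j _ /=.
    by rewrite mmapZ rmorphM /= mul_polyC.
by rewrite qE S0 big1 // => i _; rewrite big1 // => j _; rewrite mxE scale0r.
Qed.

Lemma property_QR_ge3 q k : q != 0 -> homog_ideal X q -> property_QR X k -> (3 <= k)%N.
Proof.
move=> q0 qX [G [Gquad GX]]; rewrite ltnNge; apply/negP => k2.
have G0 g : G g -> g = 0.
  move=> Gg; have [hg rg] := Gquad g Gg.
  apply: quadric_rank2_eq0 => //; first exact: leq_trans k2.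
  by apply/homog_ideal_ev/GX/ideal_gen_incl.
case/GX: qX => m [b [g [Gg E]]]; case/eqP: q0.
by rewrite E big1 // => i _; rewrite (G0 (g i)) ?mulr0.
Qed.

End RankIndexBounds.

(** * Projection from a coordinate point *)

Section CoordinatePoint.

Variables (K : closedFieldType) (N : nat) (c : 'I_N.+1).
Hypothesis charK0 : [pchar K] =i pred0.
Hypothesis c_ge3 : (3 <= c)%N.
Hypothesis c_le : (c + 3 <= N)%N.
Variable B : 'M[K]_(N.+1, N).
Hypothesis kerB : (kermx B == coordinate_point K c)%MS.
Let X := projection_image B (@rational_normal_curve K N).

Let N_gt0 : (0 < N)%N. Proof. by lia. Qed.

Let a_neq0 : coordinate_point K c != 0.
Proof.
apply/eqP => /rowP/(_ c); rewrite !mxE !eqxx => /eqP.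
by rewrite oner_eq0.
Qed.

Let row_functional_coord u : row_functional (coordinate_point K c) u = u`_c.
Proof.
rewrite /row_functional (bigD1 c) //= mxE !eqxx mul1r big1 ?addr0 // => i ic.
by rewrite mxE (negPf ic) andbF mul0r.
Qed.

Let hyperplaneE (u : {poly K}) : (size u <= N.+1)%N /\ u`_c = 0 ->
  hyperplane_form (coordinate_point K c) u.
Proof. by case=> su uc; split; rewrite // row_functional_coord. Qed.

Let z i := lift_form B 'X^i.

Let exchange i j k l : [&& (i <= N) && (i != c), (j <= N) && (j != c),
    (k <= N) && (k != c) & (l <= N) && (l != c)]%N -> (i + j = k + l)%N ->
  ideal_gen (quadrics_of_rank B 3) (z i * z j - z k * z l).
Proof.
apply: (monomial_exchange charK0 (ideal_gen_ideal _) _ c_ge3 c_le).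
move=> u1 u2 u3 /hyperplaneE W1 /hyperplaneE W2 /hyperplaneE W3.
exact: (quadric3_in_ideal a_neq0 kerB N_gt0 charK0).
Qed.

(** Vanishing on the curve says that the coefficients [F k l] of [q] in the products [z k * z l] sum
    to 0 along every antidiagonal, so each product can be compared with one representative of its
    antidiagonal. *)
Lemma quadric_in_ideal3 q : q \is 2.-homog -> vanishes_on X q ->
  ideal_gen (quadrics_of_rank B 3) q.
Proof.
have idJ := ideal_gen_ideal (quadrics_of_rank B 3).
move=> hq /(vanishes_onP a_neq0 kerB N_gt0 hq) evq.
have Bc j : B c j = 0.
  have /sub_kermxP : (coordinate_point K c <= kermx B)%MS by case/andP: kerB.
  by rewrite -rowE => /rowP/(_ j); rewrite !mxE.
pose M := quadric_mx q; pose F := B *m M *m B^T.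
(* Row [c] of [B] is zero; this removes [z c], the lift of a monomial outside the hyperplane. *)
have F0 k l : (k == c) || (l == c) -> F k l = 0.
  case/orP=> /eqP->; rewrite mxE big1 // => j _.
    by rewrite mxE big1 ?mul0r // => i _; rewrite Bc mul0r.
  by rewrite !mxE Bc mulr0.
have two_neq0 : 2%:R != 0 :> K by have /pcharf0P-> := charK0.
have expand (R : comAlgType K) (y : 'I_N -> R) (x : 'I_N.+1 -> R) :
    (forall i, y i = \sum_k B k i *: x k) ->
    \sum_i \sum_j M i j *: (y i * y j) = \sum_k \sum_l F k l *: (x k * x l).
  move=> yE.
  under eq_bigr => i _ do under eq_bigr => j _ do rewrite !yE mulr_suml scaler_sumr.
  under eq_bigr => i _ do rewrite exchange_big.
  rewrite exchange_big; apply: eq_bigr => k _ /=.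
  under eq_bigr => i _ do under eq_bigr => j _ do rewrite mulr_sumr scaler_sumr.
  under eq_bigr => i _ do rewrite exchange_big.
  rewrite exchange_big; apply: eq_bigr => l _ /=.
  rewrite [in RHS]mxE scaler_suml exchange_big; apply: eq_bigr => j _ /=.
  rewrite [in RHS]mxE mulr_suml scaler_suml; apply: eq_bigr => i _ /=.
  by rewrite !mxE -scalerAl -scalerAr !scalerA; congr (_ *: _); ring.
have wE j : coordinate_poly B j = \sum_(k < N.+1) B k j *: 'X^k.
  rewrite (poly_sum_bound (size_poly _ _ : size (coordinate_poly B j) <= N.+1)%N).
  by apply: eq_bigr => k _; rewrite coef_rVpoly_ord !mxE.
have qE : q = \sum_k \sum_l F k l *: (z k * z l).
  rewrite {1}(quadric_mxP two_neq0 hq); apply: expand => i.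
  rewrite -(lift_coordinate_poly a_neq0 kerB) wE linear_sum.
  by apply: eq_bigr => k _; rewrite linearZ.
have evE : \sum_k \sum_l F k l *: 'X^(k + l) = 0 :> {poly K}.
  under eq_bigr => k _ do under eq_bigr => l _ do rewrite exprD.
  rewrite -(expand _ _ _ wE) -[RHS]evq [in RHS](quadric_mxP two_neq0 hq).
  rewrite /curve_ev raddf_sum; apply: eq_bigr => i _ /=.
  rewrite [RHS]raddf_sum; apply: eq_bigr => j _ /=.
  by rewrite mmapZ rmorphM /= !mmapX !mmap1U mul_polyC.
pose valid m (kl : 'I_N.+1 * 'I_N.+1) :=
  [&& kl.1 + kl.2 == m, kl.1 != c & kl.2 != c]%N.
(* The default 0 is taken only on antidiagonals all of whose pairs involve [c], where [F]
   vanishes. *)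
pose rep m := if [pick kl | valid m kl] is Some kl then z kl.1 * z kl.2 else 0.
have repE : \sum_k \sum_l F k l *: rep (k + l)%N = 0.
  (* The linear map taking ['X^m] to [rep m] is applied to [evE]. *)
  transitivity (\sum_(m < N + N.+1) (\sum_k \sum_l F k l *: 'X^(k + l) : {poly K})`_m *: rep m).
    under [RHS]eq_bigr => m _ do rewrite coef_sum scaler_suml.
    rewrite [RHS]exchange_big; apply: eq_bigr => k _ /=.
    under [RHS]eq_bigr => m _ do rewrite coef_sum scaler_suml.
    rewrite [RHS]exchange_big; apply: eq_bigr => l _ /=.
    have kl_lt : (k + l < N + N.+1)%N by have := ltn_ord k; have := ltn_ord l; lia.
    rewrite [RHS](bigD1 (Ordinal kl_lt)) //= coefZ coefXn eqxx mulr1 big1 ?addr0 // => m.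
    by rewrite -val_eqE /= => mkl; rewrite coefZ coefXn (negPf mkl) mulr0 scale0r.
  by rewrite evE big1 // => m _; rewrite coef0 scale0r.
rewrite qE -[X in ideal_gen _ X]subr0 -[X in _ - X]repE -sumrB.
apply: (ideal_sum idJ) => k _; rewrite -sumrB; apply: (ideal_sum idJ) => l _.
rewrite -scalerBr; have [/F0-> | ] := boolP ((k == c) || (l == c)).
  by rewrite scale0r; apply: (ideal0 idJ).
rewrite negb_or => /andP[kc lc]; apply: (idealZ idJ); rewrite /rep.
case: pickP => [[k' l'] /and3P[/eqP /= E k'c l'c]|/(_ (k, l))]; last first.
  by rewrite /valid /= eqxx kc lc.
apply: exchange; last by rewrite E.
by rewrite !leq_ord; apply/and4P.
Qed.

Lemma coordinate_quadric_neq0 : exists2 q, q != 0 & homog_ideal X q.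
Proof.
have WX i : (i <= 2)%N -> hyperplane_form (coordinate_point K c) 'X^i.
  move=> i2; apply: hyperplaneE; rewrite size_polyXn coefXn.
  by split; [lia | case: eqP => // ?; lia].
have W0 := WX 0 isT; have W1 := WX 1 isT; have W2 := WX 2 isT.
have hq : z 0 * z 2 - z 1 * z 1 \is 2.-homog.
  by apply: rpredB; apply: linform_mul_homog.
exists (z 0 * z 2 - z 1 * z 1).
  have i1 : (1 < N.+1)%N by lia.
  (* At the image of the coordinate point with index 1 the quadric has the value -1. *)
  pose y : 'rV[K]_N := delta_mx 0 (Ordinal i1) *m B.
  have rX i : (i <= 2)%N -> row_functional (delta_mx 0 (Ordinal i1)) 'X^i = (i == 1%N)%:R :> K.
    move=> i2; have lt_i : (i < N.+1)%N by lia.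
    by rewrite (row_functionalXn _ (Ordinal lt_i)) mxE eqxx -val_eqE.
  apply/eqP => q0; have := congr1 (fun q => eval_at q y) q0.
  rewrite /eval_at mevalB !mevalM meval0 -!/(eval_at _ y) !(eval_lift a_neq0 kerB) //.
  rewrite !rX ?mul0r ?sub0r ?mulr1 //= => /eqP.
  by rewrite oppr_eq0 oner_eq0.
apply: ideal_gen_incl; split; first by exists 2%N.
apply/(vanishes_onP a_neq0 kerB N_gt0 hq).
rewrite /curve_ev rmorphB !rmorphM /= -!/(curve_ev B _) !(curve_ev_lift a_neq0 kerB) //.
by rewrite expr0 mul1r subrr.
Qed.

End CoordinatePoint.

(** * Rank and apolarity put together *)

Lemma apolar_monic_self_join (K : closedFieldType) N (M : 'M[K]_N.+1)
    (a : 'rV[K]_N.+1) e (g : {poly K}) : [pchar K] =i pred0 ->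
  curve_automorphism M -> a != 0 -> (e <= N.+1)%N -> g \is monic ->
  size g = e.+1 -> apolar a e g -> self_join (@rational_normal_curve K N) e (a *m M).
Proof.
move=> charK0 Maut a0 eN g_monic sg ag.
have [s Eg] := closed_field_poly_normal g.
rewrite (monicP g_monic) scale1r in Eg.
have ss : size s = e by apply: succn_inj; rewrite -sg Eg size_prod_XsubC.
apply: (apolar_self_join (b := fun i : 'I_e => s`_i) eN) => //.
by move: ag; rewrite Eg (big_nth 0) big_mkord ss.
Qed.

Lemma kermx_automorphism (K : fieldType) m n (M : 'M[K]_m) (A : 'M[K]_(m, n))
    (a : 'rV[K]_m) : M \in unitmx ->
  (kermx A == a *m M)%MS -> (kermx (M *m A) == a)%MS.
Proof.
move=> Munit /andP[kA Ak]; apply/andP; split; last first.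
  by apply/sub_kermxP; rewrite mulmxA; apply/sub_kermxP.
rewrite -(submxMfree _ _ (C := M)) ?row_free_unit //; apply: submx_trans kA.
by apply/sub_kermxP; rewrite -mulmxA mulmx_ker.
Qed.

Lemma quadrics_of_rank_ext (K : closedFieldType) N (B B' : 'M[K]_(N.+1, N)) k q :
  (forall y, projection_image B (@rational_normal_curve K N) y <->
             projection_image B' (@rational_normal_curve K N) y) ->
  quadrics_of_rank B k q -> quadrics_of_rank B' k q.
Proof. by move=> BB' [hq rq qX]; split=> // y /BB'; apply: qX. Qed.

(** ['X^(c.+1)] is apolar to the coordinate point, and ['X^((N - c).+1)] is apolar to it in the
    coordinate [1 / x]. Each bounds the rank by its degree. *)
Lemma coordinate_point_bounds (K : closedFieldType) N (p : 'rV[K]_N.+1) (c : 'I_N.+1) d :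
  [pchar K] =i pred0 -> p != 0 -> (p == coordinate_point K c)%MS ->
  has_rank (@rational_normal_curve K N) p d -> (d <= c.+1)%N /\ (d + c <= N.+1)%N.
Proof.
move=> charK0 p0 pc [_ rank_p].
have [l l0 Ep] := row_eqmx_scale pc p0.
have pE i : i != c -> p 0 i = 0 by move=> ic; rewrite Ep !mxE (negPf ic) andbF mulr0.
have p_X (q : {poly K}) : q`_c = 0 -> row_functional p q = 0.
  move=> qc; rewrite /row_functional big1 // => i _.
  by have [->|/pE->] := eqVneq i c; rewrite ?qc ?mulr0 ?mul0r.
have cN : (c <= N)%N by rewrite leq_ord.
split.
  apply: rank_p; split=> //; rewrite -[p]mulmx1.
  apply: (@apolar_monic_self_join K N 1%:M p c.+1 'X^(c.+1)) => //.
  - exact: curve_automorphism1.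
  - exact: monicXn.
  - by rewrite size_polyXn.
  by move=> q sq; apply: p_X; rewrite coefXnM ltnS leqnn.
suff : (d <= (N - c).+1)%N by lia.
have Munit := inversion_mx_unit 0 N charK0.
apply: rank_p; split=> //; rewrite -(mulmxKV Munit p).
apply: (@apolar_monic_self_join K N _ _ (N - c).+1 'X^((N - c).+1)) => //.
- exact: inversion_curve_automorphism.
- apply: contraNneq p0 => pM; rewrite -(mulmxKV Munit p) pM mul0mx //.
- by lia.
- exact: monicXn.
- by rewrite size_polyXn.
move=> q sq; have {}sq : (size q <= c)%N by lia.
rewrite (poly_sum_bound sq) mulr_sumr linear_sum big1 // => i _.
rewrite -scalerAr linearZ /= -exprD.
have -> : 'X^((N - c).+1 + i) = inversion_poly 0 N 'X^(c - i.+1) :> {poly K}.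
  have lt_ci : (c - i.+1 < N.+1)%N by lia.
  rewrite /inversion_poly (bigD1 (Ordinal lt_ci)) //= big1 ?addr0 => [|j].
    rewrite coefXn eqxx !scale1r scale0r add0r expr1n mulr1; congr (_ ^+ _).
    by have := ltn_ord i; lia.
  by rewrite -val_eqE /= => jN; rewrite coefXn (negPf jN) scale0r.
rewrite -row_functional_inversion mulmxKV // p_X ?mulr0 //.
rewrite coefXn; case: eqP => // E; exfalso.
by have := ltn_ord i; lia.
Qed.

Lemma projected_curve_quadrics4 (K : closedFieldType) N (p : 'rV[K]_N.+1)
    (A : 'M[K]_(N.+1, N)) r d f :
  [pchar K] =i pred0 -> (0 < N)%N -> p != 0 ->
  has_rank (@rational_normal_curve K N) p r -> (4 <= r)%N ->
  is_projection_from p A -> f \is d.-homog ->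
  vanishes_on (projection_image A (@rational_normal_curve K N)) f ->
  ideal_gen (quadrics_of_rank A 4) f.
Proof.
move=> charK0 N0 p0 [_ rank_p] r4 projA hf fX.
have [M [a [e0 [g0 [Maut Ep e0N [g0_monic sg0 ag0]]]]]] := apolar_chart p charK0 N0.
have a0 : a != 0 by apply: contraNneq p0 => a0; rewrite Ep a0 mul0mx.
pose Q e := exists g : {poly K}, [/\ g \is monic, size g = e.+1 & apolar a e g].
have [e [[g [g_monic sg ag]] e_min]] : exists e, is_least Q e.
  by apply: is_least_exists; exists e0, g0.
have e_le : (2 * e <= N + 2)%N.
  by have : (e <= e0)%N by [apply: e_min; exists g0]; lia.
have e_gt0 : (0 < e)%N.
  (* A monic apolar form of degree 0 would be 1, and then every coordinate of [a] would vanish. *)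
  rewrite lt0n; apply: contraNneq a0 => e0'; apply/eqP/rowP => i; rewrite mxE.
  have g1 : g = 1.
    have /size_poly1P[x x0 Eg] : size g == 1%N by rewrite sg e0'.
    by move: g_monic; rewrite Eg monicE lead_coefC => /eqP->.
  by rewrite -row_functionalXn -['X^i]mul1r -g1 ag // e0' addn0 size_polyXn.
have e_ge4 : (4 <= e)%N.
  apply: leq_trans r4 _; apply: rank_p; split=> //; rewrite Ep.
  by apply: (apolar_monic_self_join (g := g)) => //; lia.
have kerB : (kermx (M *m A) == a)%MS.
  by apply: kermx_automorphism; [case: Maut | rewrite -Ep].
have same y := @projection_image_automorphism K N N M A y Maut.
have fX' : vanishes_on (projection_image (M *m A) (@rational_normal_curve K N)) f.
  by move=> y /same; apply: fX.
have := ideal_by_quadrics4 a0 kerB N0 charK0 e_ge4 e_le g_monic sg ag _ hf fX'.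
move=> H; apply: ideal_gen_least (H _); first exact: ideal_gen_ideal.
  by move=> q /(quadrics_of_rank_ext same); apply: ideal_gen_incl.
by move=> k h h_monic sh ah; apply: e_min; exists h.
Qed.

Unset Implicit Arguments.

Theorem theorem1p1 (K : closedFieldType) (charK0 : [pchar K] =i pred0)
    (r : nat) (p : 'rV[K]_r.+2) (p_neq0 : p != 0)
    (p_notin_join2 : ~ self_join (@rational_normal_curve K r.+1) 2 p)
    (d : nat) (rank_p : has_rank (@rational_normal_curve K r.+1) p d)
    (d_ge4 : (4 <= d)%N)
    (A : 'M[K]_(r.+2, r.+1)) (projA : is_projection_from p A) :
  (exists2 k : nat,
     has_rank_index (projection_image A (@rational_normal_curve K r.+1)) k
     & (k <= 4)%N) /\
  (forall c : 'I_r.+2, (p == coordinate_point K c)%MS ->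
     (3 <= c <= r - 2)%N /\
     has_rank_index (projection_image A (@rational_normal_curve K r.+1)) 3).
Proof.
have quad4 dg f := projected_curve_quadrics4 (d := dg) (f := f)
  charK0 (ltn0Sn r) p_neq0 rank_p d_ge4 projA.
split.
  have QR4 : property_QR (projection_image A (@rational_normal_curve K r.+1)) 4.
    exact: property_QR_of_quadrics quad4.
  have [k k_least] := is_least_exists (ex_intro _ 4%N QR4).
  by exists k; [apply: k_least | apply: k_least.2].
move=> c pc; have [dc dcN] := coordinate_point_bounds charK0 p_neq0 pc rank_p.
have c_ge3 : (3 <= c)%N by lia.
have c_le : (c + 3 <= r.+1)%N by lia.
split; first by lia.
have kerA : (kermx A == coordinate_point K c)%MS.
  by apply/eqmxP; apply: eqmx_trans (eqmxP projA) (eqmxP pc).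
have c_neq0 : coordinate_point K c != 0 by rewrite -(row_eqmx0 pc).
split.
  apply: property_QR_of_quadrics => dg f hf fX.
  (* The quadrics of rank at most 4 already generate, so only quadrics have to be expressed through
     rank 3. *)
  apply: ideal_gen_least (quad4 dg f hf fX); first exact: ideal_gen_ideal.
  by move=> q [hq _ qX]; exact: (quadric_in_ideal3 charK0 c_ge3 c_le kerA hq qX).
move=> k QRk; have [q q0 qX] := coordinate_quadric_neq0 c_ge3 c_le kerA.
exact: (property_QR_ge3 charK0 (ltn0Sn r) c_neq0 kerA q0 qX QRk).
Qed.
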